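(* Let $\Theta=\tilde p/p$ be a rational inner function on $\mathbb{D}^2$ of degree $(m,n)$, let $\mathcal{K}_\Theta=\mathcal{S}_1\oplus\mathcal{S}_2$ be an orthogonal decomposition into closed subspaces with $\mathcal{S}_1$ invariant under $M_{z_1}$ and $\mathcal{S}_2$ invariant under $M_{z_2}$, and let $S^1_\Theta=P_{\mathcal{S}_2}M_{z_1}|_{\mathcal{S}_2}$. Then the numerical radius satisfies $w(S^1_\Theta)=1$ if and only if $\Theta$ has a singularity on $\mathbb{T}^2$.
   Context: $\mathbb{D}$ is the open unit disk, $\mathbb{T}$ the unit circle. A rational inner function on $\mathbb{D}^2$ is a rational function holomorphic on $\mathbb{D}^2$ with $|\Theta|=1$ a.e. on $\mathbb{T}^2$; its degree $(m,n)$: writing $\Theta=q/p$ in lowest terms, $m$ (resp. $n$) is the highest power of $z_1$ (resp. $z_2$) in $p$ or $q$. One may write $\Theta=\tilde p/p$ with $p$ a polynomial with no zeros on $\mathbb{D}^2$, $\tilde p(z)=z_1^mz_2^n\overline{p(1/\bar z_1,1/\bar z_2)}$, $p,\tilde p$ coprime; $p$ and $\tilde p$ have the same zeros on $\mathbb{T}^2$, and $\Theta$ has a singularity at a point of $\mathbb{T}^2$ exactly when $p$ vanishes there. $\mathcal{K}_\Theta=H^2(\mathbb{D}^2)\ominus\Theta H^2(\mathbb{D}^2)$. The numerical radius of $T$ is $w(T)=\sup\{|\lambda|:\lambda\in\mathcal{W}(T)\}$, where $\mathcal{W}(T)=\{\langle Th,h\rangle:\|h\|=1\}$. *)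

(* Defs.v *)
From HB Require Import structures.
From mathcomp Require Import all_boot all_order all_algebra.
From mathcomp Require Import all_classical all_reals.
From mathcomp Require Import topology normedtype sequences.
From mathcomp.real_closed Require Import complex.

Set Implicit Arguments.
Unset Strict Implicit.
Unset Printing Implicit Defensive.

Import Order.TTheory GRing.Theory Num.Theory numFieldNormedType.Exports.
Local Open Scope ring_scope.
Local Open Scope classical_set_scope.

Section H2D2.
Variable R : realType.
Local Notation C := R[i].

(* A formal power series in two variables z1, z2 is encoded by its array of
   Taylor coefficients: a j k is the coefficient of z1^j z2^k.  Elements of
   H^2(D^2) are exactly the square-summable such arrays. *)
Definition arr := nat -> nat -> C.

Definition arr_add (a b : arr) : arr := fun j k => a j k + b j k.
Definition arr_opp (a : arr) : arr := fun j k => - a j k.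
Definition arr_sub (a b : arr) : arr := fun j k => a j k - b j k.
Definition arr_scale (c : C) (a : arr) : arr := fun j k => c * a j k.
Definition arr0 : arr := fun _ _ => 0.

Definition H2 : set arr :=
  [set a : arr | exists M : R, forall N : nat,
     \sum_(j < N) \sum_(k < N) ComplexField.Normc.normc (a j k) ^+ 2 <= M].

Definition ip_partial (a b : arr) (N : nat) : C :=
  \sum_(j < N) \sum_(k < N) a j k * conjc (b j k).
Definition ip (a b : arr) : C :=
  Complex (limn (fun N => complex.Re (ip_partial a b N)))
          (limn (fun N => complex.Im (ip_partial a b N))).
Definition nsq (a : arr) : R := complex.Re (ip a a).

Definition Mz1 (a : arr) : arr := fun j k => if j is j'.+1 then a j' k else 0.
Definition Mz2 (a : arr) : arr := fun j k => if k is k'.+1 then a j k' else 0.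

Definition conv (a b : arr) : arr := fun j k =>
  \sum_(i < j.+1) \sum_(l < k.+1) a i l * b (j - i)%N (k - l)%N.

Definition closed_subspace (S : set arr) : Prop :=
  [/\ S `<=` H2, S arr0,
      (forall a b, S a -> S b -> S (arr_add a b)),
      (forall c a, S a -> S (arr_scale c a)) &
      (forall (f : nat -> arr) (g : arr), (forall k, S (f k)) -> H2 g ->
          (fun k => nsq (arr_sub (f k) g)) @ \oo --> (0 : R) -> S g)].

(* Bivariate polynomials: p : {poly {poly C}}; the coefficient of
   z1^j z2^k in p is (p`_k)`_j  (outer variable z2, inner variable z1). *)
Definition pcoef (p : {poly {poly C}}) : arr := fun j k => (p`_k)`_j.
Definition peval (p : {poly {poly C}}) (z1 z2 : C) : C := (p.[z2%:P]).[z1].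

Definition bideg_le (m n : nat) (p : {poly {poly C}}) : Prop :=
  leq (size p) n.+1 /\ forall k : nat, leq (size p`_k) m.+1.

(* reflection  p~(z) = z1^m z2^n conj(p(1/conj z1, 1/conj z2)) *)
Definition prefl (m n : nat) (p : {poly {poly C}}) : {poly {poly C}} :=
  \poly_(k < n.+1) \poly_(j < m.+1) conjc ((p`_(n - k)%N)`_(m - j)%N).

Definition pdivides (d p : {poly {poly C}}) : Prop :=
  exists r : {poly {poly C}}, p = d * r.
Definition pcoprime (p q : {poly {poly C}}) : Prop :=
  forall d, pdivides d p -> pdivides d q -> exists c : C, d = (c%:P)%:P.

(* Theta H^2 for Theta = q/p : the g in H^2 with p g = q f for some f in H^2 *)
Definition ThetaH2 (p q : {poly {poly C}}) : set arr :=
  [set g : arr | H2 g /\ exists f, H2 f /\ conv (pcoef p) g = conv (pcoef q) f].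

Definition KTheta (p q : {poly {poly C}}) : set arr :=
  [set h : arr | H2 h /\ forall g, ThetaH2 p q g -> ip h g = 0].

Definition is_proj (S : set arr) (x y : arr) : Prop :=
  S y /\ forall s, S s -> ip (arr_sub x y) s = 0.

Definition numrange_compr_z1 (S : set arr) : set C :=
  [set lam : C | exists (h y : arr), [/\ S h, nsq h = 1, is_proj S (Mz1 h) y & lam = ip y h]].

Definition numradius_compr_z1 (S : set arr) : R :=
  sup [set ComplexField.Normc.normc lam | lam in numrange_compr_z1 S].

End H2D2.

(* Main.v *)
Require Import Defs.
From HB Require Import structures.
From mathcomp Require Import all_boot all_order all_algebra.
From mathcomp Require Import all_classical all_reals.
From mathcomp Require Import topology normedtype sequences.
From mathcomp Require Import cyclic separable cyclotomic.
From mathcomp Require Import ring lra zify.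
From mathcomp.real_closed Require Import complex.

Set Implicit Arguments.
Unset Strict Implicit.
Unset Printing Implicit Defensive.

Import Order.TTheory GRing.Theory Num.Theory numFieldNormedType.Exports.
Local Open Scope ring_scope.
Local Open Scope classical_set_scope.

(** Write [B1] for the adjoint of multiplication by [z1] and [p~] for [prefl m n p].
    The space [S2] is invariant under [B1], so the numerical radius in question
    is that of [B1] on [S2]; moreover [p s] has degree less than [m] in [z1] for
    [s] in [S2], and degree less than [n] in [z2] for [s] in [S1].

    If the numerical radius is 1, [B1] has an approximate eigenvalue [l] of modulus
    one on [S2].  The relation [B1^m (p s) = 0] reads
    [sum_i p_i(z2) B1^(m-i) s = 0], so multiplication by the one-variable polynomial
    [l^m p(conj l, z2)] is not bounded below, hence that polynomial vanishes on
    the circle.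

    Conversely, if [p] vanishes at a point of the torus, then near it there are
    zeros [(z, w)] of [p] with [|w| < 1] that are not zeros of [p~].  With
    [kappa = 1 / conj z], [d(z1) = z1^m conj p(1 / conj z1, w) / (z1 - kappa)] and
    [u = d(z1) / (1 - conj w z2)], the projection of [u] to [S2] is an eigenvector
    of the compression of [z1] for the eigenvalue [kappa].  It is nonzero because
    the projection of [u] to [KTheta] is explicit, and is not in [S1].

    That an explicit function belongs to [KTheta] rests on estimates for
    multiplication by [p~ / p] and [p(z) / p(r z)].  They are proved on the slices
    [z = (t, om t)], where [p] becomes a polynomial in [t] without zeros in the
    disk and the estimates reduce to linear factors, and are then averaged
    over roots of unity [om]. *)

Section HardySpace.
Variable R : realType.
Local Notation C := R[i].
Local Notation Re := (@complex.Re R).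
Local Notation Im := (@complex.Im R).
Local Notation normc := (@ComplexField.Normc.normc R).
Local Notation arr := (arr R).
Implicit Types (a b c f g h x y : arr) (z w : C) (t : nat -> nat -> R).
Implicit Types (P Q : {poly {poly C}}) (q : {poly C}).

(** * The modulus and squared modulus of complex numbers *)

Definition normsq z : R := Re z ^+ 2 + Im z ^+ 2.

Lemma normc_sq z : normc z ^+ 2 = normsq z.
Proof. by case: z => u v /=; rewrite sqr_sqrtr // addr_ge0 ?sqr_ge0. Qed.

Lemma normc_ge0 z : 0 <= normc z.
Proof. by case: z => u v /=; exact: sqrtr_ge0. Qed.

Lemma normcJ z : normc (conjc z) = normc z.
Proof. by case: z => u v /=; rewrite sqrrN. Qed.

Lemma normcX z k : normc (z ^+ k) = normc z ^+ k.
Proof.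
elim: k => [|k IH]; first by rewrite !expr0 ComplexField.Normc.normc1.
by rewrite !exprS ComplexField.Normc.normcM IH.
Qed.

Lemma normc_eq0 z : (normc z == 0) = (z == 0).
Proof.
apply/eqP/eqP => [/ComplexField.Normc.eq0_normc //|->].
exact: ComplexField.Normc.normc0.
Qed.

Lemma normsq_ge0 z : 0 <= normsq z.
Proof. by rewrite -normc_sq sqr_ge0. Qed.

Lemma normsq0 : normsq 0 = 0.
Proof. by rewrite /normsq /= expr0n addr0. Qed.

Lemma normsq1 : normsq 1 = 1.
Proof. by rewrite /normsq /= expr0n expr1n addr0. Qed.

Lemma normsq_eq0 z : normsq z = 0 -> z = 0.
Proof.
by move=> h; apply/eqP; rewrite -normc_eq0 -sqrf_eq0 normc_sq h.
Qed.

Lemma normsqM z w : normsq (z * w) = normsq z * normsq w.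
Proof. by case: z w => [a b] [c d]; rewrite /normsq /=; ring. Qed.

Lemma normsqJ z : normsq (conjc z) = normsq z.
Proof. by case: z => a b; rewrite /normsq /= sqrrN. Qed.

Lemma normsqN z : normsq (- z) = normsq z.
Proof. by case: z => a b; rewrite /normsq /= !sqrrN. Qed.

Lemma normsqX z k : normsq (z ^+ k) = normsq z ^+ k.
Proof. by rewrite -!normc_sq normcX -!exprM mulnC. Qed.

Lemma normsqD z w : normsq (z + w) <= 2 * normsq z + 2 * normsq w.
Proof.
case: z w => [a b] [c d]; rewrite /normsq /=.
have := sqr_ge0 (a - c); have := sqr_ge0 (b - d); nra.
Qed.

(** Iterating [normsqD] costs a factor 2 per term; this crude constant is enough for the
    coefficientwise rate in [conv_dil_lip]. *)
Lemma normsq_sum_seq (I : Type) (r : seq I) (F : I -> C) :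
  normsq (\sum_(i <- r) F i) <= 2 ^+ size r * \sum_(i <- r) normsq (F i).
Proof.
elim: r => [|i r IH]; first by rewrite !big_nil normsq0 mulr0.
rewrite !big_cons /=; apply: le_trans (normsqD _ _) _.
rewrite exprS -mulrA -mulrDr ler_pM2l ?ltr0n // mulrDr lerD //.
by rewrite ler_peMl ?normsq_ge0 // exprn_ege1 // ler1n.
Qed.

Lemma mulcJ z : z * conjc z = Complex (normsq z) 0.
Proof. by case: z => a b; rewrite /normsq /=; simpc; congr Complex; ring. Qed.

Lemma ReD z w : Re (z + w) = Re z + Re w. Proof. by case: z w => [? ?] []. Qed.
Lemma ImD z w : Im (z + w) = Im z + Im w. Proof. by case: z w => [? ?] []. Qed.

Lemma Re_sum (I : Type) (r : seq I) (P : pred I) (F : I -> C) :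
  Re (\sum_(i <- r | P i) F i) = \sum_(i <- r | P i) Re (F i).
Proof. by apply: (big_morph Re ReD). Qed.

Lemma Im_sum (I : Type) (r : seq I) (P : pred I) (F : I -> C) :
  Im (\sum_(i <- r | P i) F i) = \sum_(i <- r | P i) Im (F i).
Proof. by apply: (big_morph Im ImD). Qed.

(** * Absolutely convergent double sums *)

Definition squaresum t (N : nat) : R := \sum_(j < N) \sum_(k < N) t j k.

Definition dsum t : R := limn (squaresum t).

Definition dsummable t : Prop :=
  exists M : R, forall N, squaresum (fun j k => `|t j k|) N <= M.

Lemma squaresumD t1 t2 N :
  squaresum (fun j k => t1 j k + t2 j k) N = squaresum t1 N + squaresum t2 N.
Proof.
by rewrite /squaresum -big_split; apply: eq_bigr => j _; rewrite -big_split.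
Qed.

Lemma squaresumZ (u : R) t N :
  squaresum (fun j k => u * t j k) N = u * squaresum t N.
Proof.
by rewrite /squaresum mulr_sumr; apply: eq_bigr => j _; rewrite mulr_sumr.
Qed.

Lemma squaresum_le t1 t2 N :
  (forall j k, t1 j k <= t2 j k) -> squaresum t1 N <= squaresum t2 N.
Proof. by move=> h; apply: ler_sum => j _; apply: ler_sum => k _. Qed.

(** Shifting by one row turns the square of side [N.+1] into an [N] by [N.+1] rectangle, which lies
    between two consecutive squares. *)
Definition rectsum t (M N : nat) : R := \sum_(j < M) \sum_(k < N) t j k.

Lemma rectsum_mono t M M' N N' : (forall j k, 0 <= t j k) ->
  (M <= M')%N -> (N <= N')%N -> rectsum t M N <= rectsum t M' N'.
Proof.
move=> t0 hM hN; rewrite /rectsum.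
apply: (@le_trans _ _ (\sum_(j < M) \sum_(k < N') t j k)).
  apply: ler_sum => j _.
  rewrite -!(big_mkord xpredT (fun k => t j k)) (big_cat_nat (leq0n N) hN) /=.
  by rewrite lerDl sumr_ge0.
rewrite -!(big_mkord xpredT (fun j => \sum_(k < N') t j k)).
rewrite (big_cat_nat (leq0n M) hM) /= lerDl sumr_ge0 // => j _.
exact: sumr_ge0.
Qed.

Lemma squaresum_mono t : (forall j k, 0 <= t j k) ->
  {homo squaresum t : n m / (n <= m)%N >-> n <= m}.
Proof. by move=> t0 n m nm; apply: rectsum_mono. Qed.

Lemma squaresum_ge0 t N : (forall j k, 0 <= t j k) -> 0 <= squaresum t N.
Proof. by move=> h; apply: sumr_ge0 => j _; apply: sumr_ge0. Qed.

Lemma dsummable_le t1 t2 : (forall j k, `|t1 j k| <= t2 j k) ->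
  dsummable t2 -> dsummable t1.
Proof.
move=> h [M hM]; exists M => N; apply: le_trans (hM N).
by apply: squaresum_le => j k; apply: le_trans (h _ _) (ler_norm _).
Qed.

Lemma dsummableD t1 t2 : dsummable t1 -> dsummable t2 ->
  dsummable (fun j k => t1 j k + t2 j k).
Proof.
move=> [M1 h1] [M2 h2]; exists (M1 + M2) => N.
apply: le_trans (lerD (h1 N) (h2 N)); rewrite -squaresumD.
by apply: squaresum_le => j k; apply: ler_normD.
Qed.

Lemma dsummableZ u t : dsummable t -> dsummable (fun j k => u * t j k).
Proof.
move=> [M h]; exists (`|u| * M) => N.
apply: le_trans (ler_wpM2l (normr_ge0 u) (h N)); rewrite -squaresumZ.
by apply: squaresum_le => j k; rewrite normrM.
Qed.

Lemma ge0_squaresum_cvg t : (forall j k, 0 <= t j k) -> dsummable t ->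
  cvgn (squaresum t).
Proof.
move=> t0 [M hM]; apply: nondecreasing_is_cvgn; first exact: squaresum_mono.
exists M => _ [N _ <-]; apply: le_trans (hM N).
by apply: squaresum_le => j k; apply: ler_norm.
Qed.

Lemma dsummable_norm t : dsummable t -> dsummable (fun j k => `|t j k|).
Proof.
case=> M hM; exists M => N; apply: le_trans (hM N).
by apply: squaresum_le => j k; rewrite normr_id.
Qed.

Lemma normr_add_ge0 (u : R) : 0 <= `|u| + u.
Proof. by have := ler_norm (- u); rewrite normrN; lra. Qed.

(** Writing a signed array as a difference of two nonnegative ones reduces convergence to that of
    bounded monotone sequences. *)
Lemma squaresum_split t : squaresum t =
  (fun N => squaresum (fun j k => `|t j k| + t j k) N
          + -1 * squaresum (fun j k => `|t j k|) N).
Proof. by apply/funext => N; rewrite squaresumD; ring. Qed.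

Lemma squaresum_cvg t : dsummable t -> squaresum t @ \oo --> dsum t.
Proof.
move=> ht; suff : cvgn (squaresum t) by [].
rewrite squaresum_split; have hn := dsummable_norm ht.
apply: is_cvgD; last apply: is_cvgMl_tmp.
  apply: ge0_squaresum_cvg => [j k|]; last exact: dsummableD.
  exact: normr_add_ge0.
exact: ge0_squaresum_cvg.
Qed.

Lemma dsum_uniq t (l : R) : squaresum t @ \oo --> l -> dsum t = l.
Proof. by move=> h; apply/cvg_lim. Qed.

Lemma dsumD t1 t2 : dsummable t1 -> dsummable t2 ->
  dsum (fun j k => t1 j k + t2 j k) = dsum t1 + dsum t2.
Proof.
move=> h1 h2; apply: dsum_uniq.
rewrite (funext (squaresumD t1 t2)).
by apply: cvgD; apply: squaresum_cvg.
Qed.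

Lemma dsumZ u t : dsummable t -> dsum (fun j k => u * t j k) = u * dsum t.
Proof.
move=> h; apply: dsum_uniq; rewrite (funext (squaresumZ u t)).
by apply: cvgMl_tmp; apply: squaresum_cvg.
Qed.

Lemma dsum0 : dsum (fun _ _ => 0) = 0.
Proof.
apply: dsum_uniq; rewrite (_ : squaresum _ = fun=> 0); first exact: cvg_cst.
by apply/funext => N; apply: big1 => j _; apply: big1.
Qed.

Lemma squaresum_le_dsum t N : (forall j k, 0 <= t j k) -> dsummable t ->
  squaresum t N <= dsum t.
Proof.
move=> t0 ht; apply: nondecreasing_cvgn_le; first exact: squaresum_mono.
exact: ge0_squaresum_cvg.
Qed.

Lemma dsum_le t M : dsummable t -> (forall N, squaresum t N <= M) -> dsum t <= M.
Proof.
move=> ht hM; apply: limr_le; first exact: squaresum_cvg ht.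
exact: nearW.
Qed.

Definition dshift1 t : nat -> nat -> R := fun j k => if j is j'.+1 then t j' k else 0.
Definition dswap t : nat -> nat -> R := fun j k => t k j.

Lemma squaresum_shift1 t N : squaresum (dshift1 t) N.+1 = rectsum t N N.+1.
Proof.
rewrite /squaresum /rectsum big_ord_recl big1 ?add0r //=.
Qed.

Lemma dshift1_norm t :
  (fun j k => `|dshift1 t j k|) = dshift1 (fun j k => `|t j k|).
Proof. by apply/funext => -[|j]; apply/funext => k //=; rewrite normr0. Qed.

Lemma dsummable_shift1 t : dsummable t -> dsummable (dshift1 t).
Proof.
case=> M hM; exists M => -[|N].
  by have := hM 0%N; rewrite /squaresum !big_ord0.
rewrite dshift1_norm squaresum_shift1; apply: le_trans (hM N.+1).
exact: rectsum_mono.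
Qed.

Lemma ge0_dsum_shift1 t : (forall j k, 0 <= t j k) -> dsummable t ->
  dsum (dshift1 t) = dsum t.
Proof.
move=> t0 ht; apply: dsum_uniq; rewrite -cvg_shiftS.
apply: (@squeeze_cvgr _ _ _ _ (squaresum t) [sequence squaresum t n.+1]_n).
- apply: nearW => N /=; rewrite squaresum_shift1.
  by apply/andP; split; apply: rectsum_mono.
- exact: squaresum_cvg.
- by rewrite cvg_shiftS; apply: squaresum_cvg.
Qed.

Lemma dsum_shift1 t : dsummable t -> dsum (dshift1 t) = dsum t.
Proof.
move=> ht; have hn := dsummable_norm ht.
pose P j k := `|t j k| + t j k; pose N j k := `|t j k|.
have hP : dsummable P by exact: dsummableD.
have -> : dshift1 t = (fun j k => dshift1 P j k + -1 * dshift1 N j k).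
  by apply/funext => -[|j]; apply/funext => k; rewrite /P /N /=; ring.
rewrite dsumD ?dsumZ; do ?[exact: dsummable_shift1 | apply: dsummableZ].
rewrite (ge0_dsum_shift1 _ hP); last by move=> j k; apply: normr_add_ge0.
by rewrite (ge0_dsum_shift1 _ hn) // /P dsumD //; ring.
Qed.

(** Square partial sums are symmetric, so facts about the second variable follow from those about
    the first by exchanging indices. *)
Lemma squaresum_swap t N : squaresum (dswap t) N = squaresum t N.
Proof. exact: exchange_big. Qed.

Lemma dsum_swap t : dsum (dswap t) = dsum t.
Proof. by congr (limn _); apply/funext => N; apply: squaresum_swap. Qed.

Lemma dsummable_swap t : dsummable t -> dsummable (dswap t).
Proof.
by case=> M hM; exists M => N; apply: le_trans (hM N); rewrite -squaresum_swap.
Qed.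

(** * The inner product of [H2] *)

Definition B1 a : arr := fun j k => a j.+1 k.
Definition B2 a : arr := fun j k => a j k.+1.

Lemma arrP a b : (forall j k, a j k = b j k) -> a = b.
Proof. by move=> h; apply/funext => j; apply/funext => k. Qed.

Lemma H2P a : H2 a <-> dsummable (fun j k => normsq (a j k)).
Proof.
have e N : squaresum (fun j k => `|normsq (a j k)|) N
    = \sum_(j < N) \sum_(k < N) normc (a j k) ^+ 2.
  apply: eq_bigr => j _; apply: eq_bigr => k _.
  by rewrite normc_sq ger0_norm ?normsq_ge0.
by split=> -[M hM]; exists M => N; rewrite ?e // -e.
Qed.

Lemma H2_bound a M :
  (forall N, squaresum (fun j k => normsq (a j k)) N <= M) -> H2 a.
Proof.
move=> h; apply/H2P; exists M => N; apply: le_trans (h N).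
by apply: squaresum_le => j k; rewrite ger0_norm ?normsq_ge0.
Qed.

Lemma H2_add a b : H2 a -> H2 b -> H2 (arr_add a b).
Proof.
move=> /H2P ha /H2P hb; apply/H2P.
apply: (dsummable_le (t2 := fun j k => 2 * normsq (a j k) + 2 * normsq (b j k))).
  by move=> j k; rewrite ger0_norm ?normsq_ge0 ?normsqD.
by apply: dsummableD; apply: dsummableZ.
Qed.

Lemma H2_scale u a : H2 a -> H2 (arr_scale u a).
Proof.
move=> /H2P ha; apply/H2P.
apply: (dsummable_le (t2 := fun j k => normsq u * normsq (a j k))).
  by move=> j k; rewrite ger0_norm ?normsq_ge0 // normsqM.
exact: dsummableZ.
Qed.

Lemma arr_subE a b : arr_sub a b = arr_add a (arr_scale (-1) b).
Proof. by apply: arrP => j k; rewrite /arr_sub /arr_add /arr_scale; ring. Qed.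

Lemma H2_sub a b : H2 a -> H2 b -> H2 (arr_sub a b).
Proof. by move=> ha hb; rewrite arr_subE; apply: H2_add => //; apply: H2_scale. Qed.

Lemma H2_0 : H2 (arr0 R).
Proof.
apply: (H2_bound (M := 0)) => N; rewrite /squaresum big1 // => j _; rewrite big1 // => k _.
exact: normsq0.
Qed.

Lemma H2_Mz1 a : H2 a -> H2 (Mz1 a).
Proof.
move=> /H2P ha; apply/H2P; have := dsummable_shift1 ha.
apply: dsummable_le => -[|j] k /=; first by rewrite normsq0 normr0.
by rewrite ger0_norm ?normsq_ge0.
Qed.

Lemma H2_swap a : H2 a -> H2 (fun j k => a k j).
Proof. by move=> /H2P ha; apply/H2P; exact: (dsummable_swap ha). Qed.

Lemma H2_Mz2 a : H2 a -> H2 (Mz2 a).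
Proof. by move=> /H2_swap/H2_Mz1/H2_swap. Qed.

Lemma H2_B1 a : H2 a -> H2 (B1 a).
Proof.
move=> /H2P [M hM]; apply: (H2_bound (M := M)) => N; apply: le_trans (hM N.+1).
rewrite [leRHS](_ : _ = rectsum (fun j k => `|normsq (a j k)|) N.+1 N.+1) //.
rewrite /rectsum big_ord_recl /= -[leLHS]add0r lerD //.
  by apply: sumr_ge0 => k _.
apply: ler_sum => j _; rewrite big_ord_recr /= -[leLHS]addr0 lerD //.
by apply: ler_sum => k _; rewrite ler_norm.
Qed.

Lemma H2_B2 a : H2 a -> H2 (B2 a).
Proof. by move=> /H2_swap/H2_B1/H2_swap. Qed.

Lemma ipE a b : ip a b = Complex (dsum (fun j k => Re (a j k * conjc (b j k))))
                                 (dsum (fun j k => Im (a j k * conjc (b j k)))).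
Proof.
congr Complex; congr (limn _); apply/funext => N;
  rewrite /ip_partial /squaresum ?Re_sum ?Im_sum;
  by apply: eq_bigr => j _; rewrite ?Re_sum ?Im_sum.
Qed.

(** Both parts of [a j k * conjc (b j k)] are dominated by [normsq (a j k) + normsq (b j k)]. *)
Lemma H2_summable a b : H2 a -> H2 b ->
  dsummable (fun j k => Re (a j k * conjc (b j k))) /\
  dsummable (fun j k => Im (a j k * conjc (b j k))).
Proof.
move=> /H2P ha /H2P hb.
split; apply: (dsummable_le _ (dsummableD ha hb)) => j k;
  case: (a j k) (b j k) => [u v] [s t]; rewrite /normsq /= ler_norml;
  have := sqr_ge0 (u - s); have := sqr_ge0 (u + s);
  have := sqr_ge0 (v - t); have := sqr_ge0 (v + t);
  have := sqr_ge0 (u - t); have := sqr_ge0 (u + t);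
  have := sqr_ge0 (v - s); have := sqr_ge0 (v + s);
  move=> *; apply/andP; split; nra.
Qed.

Lemma nsqE a : nsq a = dsum (fun j k => normsq (a j k)).
Proof.
rewrite /nsq ipE /=; congr dsum; apply/funext => j; apply/funext => k.
by rewrite mulcJ.
Qed.

Lemma ip_self a : ip a a = Complex (nsq a) 0.
Proof.
rewrite nsqE ipE -dsum0; congr Complex; congr dsum; apply/funext => j;
  by apply/funext => k; rewrite mulcJ.
Qed.

Lemma ipC a b : H2 a -> H2 b -> ip b a = conjc (ip a b).
Proof.
move=> ha hb; have [_ hi] := H2_summable ha hb; rewrite !ipE /=; congr Complex.
  congr dsum; apply/funext => j; apply/funext => k.
  by case: (a j k) (b j k) => [u v] [s t] /=; ring.
rewrite -mulN1r -dsumZ //; congr dsum; apply/funext => j; apply/funext => k.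
by case: (a j k) (b j k) => [u v] [s t] /=; ring.
Qed.

Lemma ipDl a b c : H2 a -> H2 b -> H2 c -> ip (arr_add a b) c = ip a c + ip b c.
Proof.
move=> ha hb hc; have [r1 i1] := H2_summable ha hc.
have [r2 i2] := H2_summable hb hc; rewrite !ipE; simpc; rewrite -!dsumD //.
congr Complex; congr dsum; apply/funext => j; apply/funext => k;
  by rewrite -?ReD -?ImD -mulrDl.
Qed.

Lemma ipZl u a b : H2 a -> H2 b -> ip (arr_scale u a) b = u * ip a b.
Proof.
move=> ha hb; have [hr hi] := H2_summable ha hb; case: u => s t.
rewrite !ipE; simpc; rewrite -!dsumZ // -mulN1r -dsumZ; last exact: dsummableZ.
rewrite -!dsumD; do ?[apply: dsummableZ => //].
congr Complex; congr dsum; apply/funext => j; apply/funext => k;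
  by rewrite /arr_scale; case: (a j k) (b j k) => [a1 a2] [b1 b2] /=; ring.
Qed.

Lemma ip_Mz1 a b : H2 a -> H2 b -> ip (Mz1 a) b = ip a (B1 b).
Proof.
move=> ha hb; have [hr hi] := H2_summable ha (H2_B1 hb).
rewrite !ipE -(dsum_shift1 hr) -(dsum_shift1 hi).
congr Complex; congr dsum; apply/funext => -[|j]; apply/funext => k //=;
  by rewrite mul0r.
Qed.

Lemma ip_swap a b : ip (fun j k => a k j) (fun j k => b k j) = ip a b.
Proof. by rewrite !ipE; congr Complex; apply: dsum_swap. Qed.

Lemma ip_Mz2 a b : H2 a -> H2 b -> ip (Mz2 a) b = ip a (B2 b).
Proof.
move=> ha hb; rewrite -(ip_swap (Mz2 a)).
by rewrite (ip_Mz1 (H2_swap ha) (H2_swap hb)) (ip_swap a (B2 b)).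
Qed.

Lemma ip0l b : ip (arr0 R) b = 0.
Proof.
rewrite ipE -[RHS]/(Complex 0 0) -dsum0; congr Complex; congr dsum;
  by apply/funext => j; apply/funext => k; rewrite mul0r.
Qed.

Lemma ip0r a : ip a (arr0 R) = 0.
Proof.
rewrite ipE -[RHS]/(Complex 0 0) -dsum0; congr Complex; congr dsum;
  by apply/funext => j; apply/funext => k; rewrite conjc0 mulr0.
Qed.

Lemma ipDr a b c : H2 a -> H2 b -> H2 c -> ip a (arr_add b c) = ip a b + ip a c.
Proof.
move=> ha hb hc; rewrite (ipC (H2_add hb hc) ha) ipDl // rmorphD.
by rewrite (ipC hb ha) (ipC hc ha).
Qed.

Lemma ipZr u a b : H2 a -> H2 b -> ip a (arr_scale u b) = conjc u * ip a b.
Proof.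
by move=> ha hb; rewrite (ipC (H2_scale u hb) ha) ipZl // rmorphM (ipC hb ha).
Qed.

Lemma ipBl a b c : H2 a -> H2 b -> H2 c -> ip (arr_sub a b) c = ip a c - ip b c.
Proof.
by move=> ha hb hc; rewrite arr_subE ipDl ?ipZl ?mulN1r //; apply: H2_scale.
Qed.

Lemma ipBr a b c : H2 a -> H2 b -> H2 c -> ip a (arr_sub b c) = ip a b - ip a c.
Proof.
move=> ha hb hc; rewrite arr_subE ipDr ?ipZr ?rmorphN ?rmorph1 ?mulN1r //.
exact: H2_scale.
Qed.

Lemma nsq_summable a : H2 a -> dsummable (fun j k => normsq (a j k)).
Proof. by move/H2P. Qed.

Lemma squaresum_le_nsq a N : H2 a ->
  squaresum (fun j k => normsq (a j k)) N <= nsq a.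
Proof.
move=> /H2P ha; rewrite nsqE squaresum_le_dsum // => j k; exact: normsq_ge0.
Qed.

Lemma nsq_ge0 a : H2 a -> 0 <= nsq a.
Proof.
by move=> ha; apply: le_trans (squaresum_le_nsq 0 ha); rewrite /squaresum big_ord0.
Qed.

Lemma nsq_le a M : (forall N, squaresum (fun j k => normsq (a j k)) N <= M) ->
  nsq a <= M.
Proof. by move=> h; rewrite nsqE; apply: dsum_le => //; apply/H2P/(H2_bound h). Qed.

Lemma normsq_le_nsq a j k : H2 a -> normsq (a j k) <= nsq a.
Proof.
move=> ha; apply: le_trans (squaresum_le_nsq (maxn j k).+1 ha).
have hj : (j < (maxn j k).+1)%N by rewrite ltnS leq_maxl.
have hk : (k < (maxn j k).+1)%N by rewrite ltnS leq_maxr.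
rewrite /squaresum (bigD1 (Ordinal hj)) //= (bigD1 (Ordinal hk)) //= -addrA.
rewrite lerDl addr_ge0 ?sumr_ge0 // => [i _|i _]; first exact: normsq_ge0.
by rewrite sumr_ge0 // => l _; apply: normsq_ge0.
Qed.

Lemma nsq_eq0 a : H2 a -> nsq a = 0 -> a = arr0 R.
Proof.
move=> ha h0; apply: arrP => j k; apply: normsq_eq0.
by apply/le_anti; rewrite normsq_ge0 andbT -h0 normsq_le_nsq.
Qed.

Lemma nsq_scale u a : H2 a -> nsq (arr_scale u a) = normsq u * nsq a.
Proof.
move=> ha; rewrite !nsqE -dsumZ; last exact: nsq_summable.
by congr dsum; apply/funext => j; apply/funext => k; rewrite -normsqM.
Qed.

Lemma nsq_add a b : H2 a -> H2 b ->
  nsq (arr_add a b) = nsq a + nsq b + 2 * Re (ip a b).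
Proof.
move=> ha hb; have hab := H2_add ha hb; rewrite {1}/nsq ipDl // !ipDr //.
rewrite !ip_self (ipC ha hb); case: (ip a b) => u v; rewrite /=; simpc => /=.
by ring.
Qed.

Lemma nsq_sub a b : H2 a -> H2 b ->
  nsq (arr_sub a b) = nsq a + nsq b - 2 * Re (ip a b).
Proof.
move=> ha hb; rewrite arr_subE nsq_add ?nsq_scale ?ipZr //; last exact: H2_scale.
rewrite normsqN normsq1; case: (ip a b) => u v; rewrite rmorphN1 mulN1r /=.
by ring.
Qed.

Lemma nsq_add_le a b : H2 a -> H2 b ->
  nsq (arr_add a b) <= 2 * nsq a + 2 * nsq b.
Proof.
move=> ha hb; have := nsq_ge0 (H2_sub ha hb); rewrite nsq_sub // nsq_add //; lra.
Qed.

(** Expand the squared norm of [nsq b] times [a] minus [ip a b] times [b], and divide by [nsq b]; if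
    [nsq b = 0] then [b] vanishes. *)
Lemma ip_CS a b : H2 a -> H2 b -> normsq (ip a b) <= nsq a * nsq b.
Proof.
move=> ha hb; have [b0|b0] := eqVneq (nsq b) 0.
  by rewrite b0 mulr0 (nsq_eq0 hb b0) ip0r normsq0.
have bp : 0 < nsq b by rewrite lt_neqAle eq_sym b0 nsq_ge0.
have := nsq_ge0 (H2_sub (H2_scale (Complex (nsq b) 0) ha) (H2_scale (ip a b) hb)).
rewrite nsq_sub ?nsq_scale ?ipZl ?ipZr //; do ?exact: H2_scale.
move: (ip a b) => I; rewrite [_ * I]mulrC mulcJ /normsq /=.
rewrite !(expr0n, addr0, mulr0, subr0, mul0r) /= => h.
by rewrite -(ler_pM2l bp); nra.
Qed.

Lemma nsq_Mz1 a : H2 a -> nsq (Mz1 a) = nsq a.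
Proof.
move=> ha; rewrite !nsqE -(dsum_shift1 (nsq_summable ha)); congr dsum.
by apply/funext => -[|j]; apply/funext => k //=; rewrite normsq0.
Qed.

Lemma nsq_swap a : nsq (fun j k => a k j) = nsq a.
Proof. by rewrite /nsq ip_swap. Qed.

Lemma nsq_Mz2 a : H2 a -> nsq (Mz2 a) = nsq a.
Proof.
by move=> ha; rewrite -(nsq_swap (Mz2 a)) (nsq_Mz1 (H2_swap ha)) nsq_swap.
Qed.

Lemma nsq_B1 a : H2 a -> nsq (B1 a) <= nsq a.
Proof.
move=> ha; apply: nsq_le => N; apply: le_trans (squaresum_le_nsq N.+1 ha).
rewrite [leRHS](_ : _ = rectsum (fun j k => normsq (a j k)) N.+1 N.+1) //.
rewrite /rectsum big_ord_recl /= -[leLHS]add0r lerD //.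
  by apply: sumr_ge0 => k _; apply: normsq_ge0.
apply: ler_sum => j _; rewrite big_ord_recr /= -[leLHS]addr0 lerD //.
exact: normsq_ge0.
Qed.

(** * Formal power series *)

Lemma sum_ord_trunc (V : zmodType) (F : nat -> V) (M N : nat) :
  (forall i, (M <= i)%N -> F i = 0) -> (M <= N)%N ->
  \sum_(i < N) F i = \sum_(i < M) F i.
Proof.
move=> h MN; rewrite -!(big_mkord xpredT F) (big_cat_nat (leq0n M) MN) /=.
by rewrite [X in _ + X]big_nat [X in _ + X]big1 ?addr0 // => i /andP[hi _]; apply: h.
Qed.

Lemma conv_local a a' b b' j k :
  (forall i l, (i <= j)%N -> (l <= k)%N -> a i l = a' i l) ->
  (forall i l, (i <= j)%N -> (l <= k)%N -> b i l = b' i l) ->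
  conv a b j k = conv a' b' j k.
Proof.
move=> ha hb; apply: eq_bigr => i _; apply: eq_bigr => l _.
by rewrite ha ?hb ?leq_subr // -ltnS.
Qed.

Lemma conv_pcoef P Q : conv (pcoef P) (pcoef Q) = pcoef (P * Q).
Proof.
apply: arrP => j k; rewrite /pcoef coefM coef_sum /conv exchange_big.
by apply: eq_bigr => l _; rewrite coefM.
Qed.

(** A coefficient of [conv a b] involves finitely many entries, so the ring laws of [conv] are
    inherited from polynomials by truncating the series. *)
Definition trunc (N : nat) a : {poly {poly C}} :=
  \poly_(k < N) \poly_(j < N) a j k.

Lemma pcoef_trunc N a j k : (j < N)%N -> (k < N)%N -> pcoef (trunc N a) j k = a j k.
Proof. by move=> hj hk; rewrite /pcoef coef_poly hk coef_poly hj. Qed.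

Lemma conv_trunc N a b j k : (j < N)%N -> (k < N)%N ->
  conv a b j k = pcoef (trunc N a * trunc N b) j k.
Proof.
move=> hj hk; rewrite -conv_pcoef; apply: conv_local => i l hi hl;
  by rewrite pcoef_trunc ?(leq_ltn_trans hi) ?(leq_ltn_trans hl) //.
Qed.

Lemma convC a b : conv a b = conv b a.
Proof.
apply: arrP => j k; have hj : (j < (j + k).+1)%N by rewrite ltnS leq_addr.
have hk : (k < (j + k).+1)%N by rewrite ltnS leq_addl.
by rewrite !(conv_trunc _ _ hj hk) mulrC.
Qed.

Lemma convA a b c : conv a (conv b c) = conv (conv a b) c.
Proof.
apply: arrP => j k; have hj : (j < (j + k).+1)%N by rewrite ltnS leq_addr.
have hk : (k < (j + k).+1)%N by rewrite ltnS leq_addl.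
set N := (j + k).+1 in hj hk.
transitivity (pcoef (trunc N a * trunc N b * trunc N c) j k).
  rewrite -mulrA -conv_pcoef; apply: conv_local => i l hi hl.
    by rewrite pcoef_trunc ?(leq_ltn_trans hi) ?(leq_ltn_trans hl) //.
  by rewrite -conv_trunc ?(leq_ltn_trans hi) ?(leq_ltn_trans hl) //.
rewrite -conv_pcoef; apply: conv_local => i l hi hl.
  by rewrite -conv_trunc ?(leq_ltn_trans hi) ?(leq_ltn_trans hl) //.
by rewrite pcoef_trunc ?(leq_ltn_trans hi) ?(leq_ltn_trans hl) //.
Qed.

Lemma convCA a b c : conv a (conv b c) = conv b (conv a c).
Proof. by rewrite !convA (convC a). Qed.

Lemma conv_add a b c : conv a (arr_add b c) = arr_add (conv a b) (conv a c).
Proof.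
apply: arrP => j k; rewrite /arr_add /conv -big_split; apply: eq_bigr => i _.
by rewrite -big_split; apply: eq_bigr => l _; rewrite mulrDr.
Qed.

Lemma conv_scale u a b : conv a (arr_scale u b) = arr_scale u (conv a b).
Proof.
apply: arrP => j k; rewrite /arr_scale /conv mulr_sumr; apply: eq_bigr => i _.
by rewrite mulr_sumr; apply: eq_bigr => l _; rewrite mulrCA.
Qed.

Lemma conv_sub a b c : conv a (arr_sub b c) = arr_sub (conv a b) (conv a c).
Proof. by rewrite !arr_subE conv_add conv_scale. Qed.

Lemma conv_poly P Q a : conv (pcoef P) (conv (pcoef Q) a) = conv (pcoef (P * Q)) a.
Proof. by rewrite convA conv_pcoef. Qed.

Lemma conv1l a : conv (pcoef 1) a = a.
Proof.
apply: arrP => j k; have hj : (j < (j + k).+1)%N by rewrite ltnS leq_addr.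
have hk : (k < (j + k).+1)%N by rewrite ltnS leq_addl.
rewrite -[RHS](pcoef_trunc a hj hk) -[in RHS](mul1r (trunc _ _)) -conv_pcoef.
by apply: conv_local => // i l hi hl;
  rewrite pcoef_trunc ?(leq_ltn_trans hi) ?(leq_ltn_trans hl) //.
Qed.

Lemma Mz1_conv a : Mz1 a = conv (pcoef ('X)%:P) a.
Proof.
apply: arrP => j k; have hj : (j < (j + k).+1)%N by rewrite ltnS leq_addr.
have hk : (k < (j + k).+1)%N by rewrite ltnS leq_addl.
transitivity (pcoef ('X%:P * trunc (j + k).+1 a) j k).
  rewrite /pcoef coefCM coefXM; case: j hj hk => [|j] //= hj hk.
  by rewrite -[RHS]/(pcoef _ _ _) pcoef_trunc // ltnW.
rewrite -conv_pcoef; apply: conv_local => // i l hi hl.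
by rewrite pcoef_trunc ?(leq_ltn_trans hi) ?(leq_ltn_trans hl) //.
Qed.

Lemma Mz2_conv a : Mz2 a = conv (pcoef 'X) a.
Proof.
apply: arrP => j k; have hj : (j < (j + k).+1)%N by rewrite ltnS leq_addr.
have hk : (k < (j + k).+1)%N by rewrite ltnS leq_addl.
transitivity (pcoef ('X * trunc (j + k).+1 a) j k).
  rewrite /pcoef coefXM; case: k hj hk => [|k] //= hj hk; first by rewrite coef0.
  by rewrite -[RHS]/(pcoef _ _ _) pcoef_trunc // ltnW.
rewrite -conv_pcoef; apply: conv_local => // i l hi hl.
by rewrite pcoef_trunc ?(leq_ltn_trans hi) ?(leq_ltn_trans hl) //.
Qed.

Lemma conv_Mz1 a b : conv a (Mz1 b) = Mz1 (conv a b).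
Proof. by rewrite !Mz1_conv convCA. Qed.

Lemma conv_Mz2 a b : conv a (Mz2 b) = Mz2 (conv a b).
Proof. by rewrite !Mz2_conv convCA. Qed.

Lemma iter_Mz1E i a j k :
  iter i (@Mz1 R) a j k = if (i <= j)%N then a (j - i)%N k else 0.
Proof.
by elim: i j => [|i IH] [|j] //=; rewrite IH; case: ifP => // /eqP.
Qed.

Lemma iter_Mz2E l a j k :
  iter l (@Mz2 R) a j k = if (l <= k)%N then a j (k - l)%N else 0.
Proof. by elim: l k => [|l IH] [|k] //=; rewrite IH. Qed.

(** The sum for a coefficient may be cut off at the index of that coefficient or at the bidegree of
    [P]; both agree with the sum over a common larger range. Multiplication by [P] thus becomes a
    finite combination of shifts on [H2]. *)
Lemma conv_bideg m n P a j k : bideg_le m n P ->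
  conv (pcoef P) a j k = \sum_(i < m.+1) \sum_(l < n.+1)
    pcoef P i l * iter i (@Mz1 R) (iter l (@Mz2 R) a) j k.
Proof.
move=> [hn hm].
pose F i l := pcoef P i l * iter i (@Mz1 R) (iter l (@Mz2 R) a) j k.
have F1 i l : (m.+1 <= i)%N -> F i l = 0.
  by move=> hi; rewrite /F /pcoef [X in X * _]nth_default ?mul0r // (leq_trans (hm l)).
have F2 i l : (n.+1 <= l)%N -> F i l = 0.
  move=> hl; rewrite /F /pcoef (_ : P`_l = 0) ?coef0 ?mul0r //.
  by rewrite nth_default // (leq_trans hn).
have F3 i l : (j.+1 <= i)%N -> F i l = 0.
  by move=> hi; rewrite /F iter_Mz1E leqNgt hi mulr0.
have F4 i l : (k.+1 <= l)%N -> F i l = 0.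
  move=> hl; rewrite /F iter_Mz1E iter_Mz2E leqNgt.
  by rewrite [(l <= k)%N]leqNgt hl /= if_same mulr0.
have G A B : (forall i l, (A <= i)%N -> F i l = 0) ->
    (forall i l, (B <= l)%N -> F i l = 0) -> (A <= (maxn m j).+1)%N ->
    (B <= (maxn n k).+1)%N -> \sum_(i < (maxn m j).+1) \sum_(l < (maxn n k).+1) F i l
    = \sum_(i < A) \sum_(l < B) F i l.
  move=> h1 h2 hA hB.
  rewrite (@sum_ord_trunc _ (fun i => \sum_(l < (maxn n k).+1) F i l) A) //.
    by apply: eq_bigr => i _; apply: sum_ord_trunc => // l; apply: h2.
  by move=> i hi; apply: big1 => l _; apply: h1.
rewrite -(G m.+1 n.+1) // ?ltnS ?leq_maxl // (G j.+1 k.+1) // ?ltnS ?leq_maxr //.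
apply: eq_bigr => -[i hi] _; apply: eq_bigr => -[l hl] _ /=.
by rewrite /F iter_Mz1E -ltnS hi iter_Mz2E -ltnS hl.
Qed.

Lemma H2_sum (M : nat) (G : nat -> arr) : (forall i, H2 (G i)) ->
  H2 (fun j k => \sum_(i < M) G i j k).
Proof.
move=> h; elim: M => [|M IH].
  rewrite (_ : (fun _ _ => _) = arr0 R); first exact: H2_0.
  by apply: arrP => j k; rewrite big_ord0.
rewrite (_ : (fun _ _ => _) = arr_add (fun j k => \sum_(i < M) G i j k) (G M)).
  exact: H2_add.
by apply: arrP => j k; rewrite big_ord_recr.
Qed.

Lemma ip_sum (M : nat) (G : nat -> arr) b : (forall i, H2 (G i)) -> H2 b ->
  ip (fun j k => \sum_(i < M) G i j k) b = \sum_(i < M) ip (G i) b.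
Proof.
move=> h hb; elim: M => [|M IH].
  rewrite big_ord0 (_ : (fun _ _ => _) = arr0 R) ?ip0l //.
  by apply: arrP => j k; rewrite big_ord0.
rewrite (_ : (fun _ _ => _) = arr_add (fun j k => \sum_(i < M) G i j k) (G M)).
  by rewrite ipDl // ?IH ?big_ord_recr //; apply: H2_sum.
by apply: arrP => j k; rewrite big_ord_recr.
Qed.

Lemma ip_sumr (M : nat) (G : nat -> arr) b : (forall i, H2 (G i)) -> H2 b ->
  ip b (fun j k => \sum_(i < M) G i j k) = \sum_(i < M) ip b (G i).
Proof.
move=> h hb; rewrite (ipC (H2_sum M h) hb) ip_sum // rmorph_sum.
by apply: eq_bigr => i _; rewrite [RHS](ipC (h i) hb).
Qed.

Lemma H2_iterMz i l a : H2 a -> H2 (iter i (@Mz1 R) (iter l (@Mz2 R) a)).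
Proof.
move=> ha; elim: i => [|i IH]; last exact: H2_Mz1.
by elim: l => [|l IH] //=; apply: H2_Mz2.
Qed.

Lemma H2_iterB i l a : H2 a -> H2 (fun j k => a (j + i)%N (k + l)%N).
Proof.
move=> ha; elim: i => [|i IH].
  elim: l => [|l IH].
    by rewrite (_ : (fun _ _ => _) = a) //; apply: arrP => j k; rewrite !addn0.
  have := H2_B2 IH; congr H2; apply: arrP => j k; rewrite /B2 addSnnS //.
by have := H2_B1 IH; congr H2; apply: arrP => j k; rewrite /B1 addSnnS.
Qed.

Lemma ip_iter i l a b : H2 a -> H2 b ->
  ip (iter i (@Mz1 R) (iter l (@Mz2 R) a)) b
  = ip a (fun j k => b (j + i)%N (k + l)%N).
Proof.
move=> ha; elim: i b => [|i IH] b hb; last first.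
  rewrite iterS ip_Mz1 //; last exact: H2_iterMz.
  rewrite IH; last exact: H2_B1.
  by congr ip; apply: arrP => j k; rewrite /B1 addnS.
elim: l b hb => [|l IH] b hb.
  by congr ip; apply: arrP => j k; rewrite !addn0.
rewrite /= ip_Mz2 //; last exact: (H2_iterMz 0 l ha).
rewrite [LHS]IH; last exact: H2_B2.
by congr ip; apply: arrP => j k; rewrite /B2 addnS.
Qed.

Lemma convE m n P a : bideg_le m n P ->
  conv (pcoef P) a = (fun j k => \sum_(i < m.+1) (fun j k => \sum_(l < n.+1)
    arr_scale (pcoef P i l) (iter i (@Mz1 R) (iter l (@Mz2 R) a)) j k) j k).
Proof. by move=> h; apply: arrP => j k; rewrite (conv_bideg _ _ _ h). Qed.

Lemma H2_conv m n P a : bideg_le m n P -> H2 a -> H2 (conv (pcoef P) a).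
Proof.
move=> h ha; rewrite (convE _ h).
apply: (H2_sum m.+1 (G := fun i j k => \sum_(l < n.+1) arr_scale (pcoef P i l)
  (iter i (@Mz1 R) (iter l (@Mz2 R) a)) j k)) => i.
apply: (H2_sum n.+1 (G := fun l => arr_scale (pcoef P i l)
  (iter i (@Mz1 R) (iter l (@Mz2 R) a)))) => l.
exact/H2_scale/H2_iterMz.
Qed.

(** The Hilbert-space adjoint of multiplication by [P]: backward shifts replace shifts. *)
Definition adj (m n : nat) P b : arr := fun j k =>
  \sum_(i < m.+1) \sum_(l < n.+1) conjc (pcoef P i l) * b (j + i)%N (k + l)%N.

Lemma H2_adj m n P b : H2 b -> H2 (adj m n P b).
Proof.
move=> hb.
apply: (H2_sum m.+1 (G := fun i j k => \sum_(l < n.+1)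
  conjc (pcoef P i l) * b (j + i)%N (k + l)%N)) => i.
apply: (H2_sum n.+1 (G := fun l => arr_scale (conjc (pcoef P i l))
  (fun j k => b (j + i)%N (k + l)%N))) => l.
exact/H2_scale/H2_iterB.
Qed.

Lemma ip_conv_adj m n P a b : bideg_le m n P -> H2 a -> H2 b ->
  ip (conv (pcoef P) a) b = ip a (adj m n P b).
Proof.
move=> h ha hb; rewrite (convE _ h).
have h1 i l : H2 (arr_scale (pcoef P i l) (iter i (@Mz1 R) (iter l (@Mz2 R) a))).
  exact/H2_scale/H2_iterMz.
have h2 i l : H2 (arr_scale (conjc (pcoef P i l)) (fun j k => b (j + i)%N (k + l)%N)).
  exact/H2_scale/H2_iterB.
rewrite (ip_sum m.+1 (G := fun i j k => \sum_(l < n.+1) arr_scale (pcoef P i l)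
  (iter i (@Mz1 R) (iter l (@Mz2 R) a)) j k)) //; last first.
  by move=> i; apply: (H2_sum n.+1 (h1 i)).
rewrite (ip_sumr m.+1 (G := fun i j k => \sum_(l < n.+1)
  arr_scale (conjc (pcoef P i l)) (fun j k => b (j + i)%N (k + l)%N) j k)) //;
  last by move=> i; apply: (H2_sum n.+1 (h2 i)).
apply: eq_bigr => i _; rewrite (ip_sum n.+1 (h1 i) hb) (ip_sumr n.+1 (h2 i) ha).
apply: eq_bigr => l _; rewrite ipZl ?ipZr ?conjcK ?ip_iter //.
- exact: H2_iterB.
- exact: H2_iterMz.
Qed.

(** Each factor without constant term raises the order of vanishing at the origin by at least
    one. *)
Lemma pcoef_expr (e : {poly {poly C}}) d j k : pcoef e 0 0 = 0 ->
  (j + k < d)%N -> pcoef (e ^+ d) j k = 0.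
Proof.
move=> e0; elim: d j k => [|d IH] j k // h.
rewrite exprS -conv_pcoef /conv big1 // => i _; rewrite big1 // => l _.
have [|il] := ltnP 0 (i + l); last first.
  have [-> ->] : nat_of_ord i = 0%N /\ nat_of_ord l = 0%N by lia.
  by rewrite e0 mul0r.
move=> il; rewrite IH ?mulr0 //; have := ltn_ord i; have := ltn_ord l; lia.
Qed.

(** With [q] the inverse of the constant term and [e = 1 - q P], the inverse is [q] times the
    geometric series in [e]; each coefficient stabilises by [pcoef_expr]. Formal quotients by [p]
    become available before any convergence is known. *)
Lemma conv_inv P : pcoef P 0 0 != 0 -> exists c, conv (pcoef P) c = pcoef 1.
Proof.
move=> p0; pose q : {poly {poly C}} := ((pcoef P 0 0)^-1)%:P%:P.
pose e := 1 - q * P.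
have e0 : pcoef e 0 0 = 0.
  by rewrite /e /pcoef !(coefB, coefCM, coef1) /= mulVf ?subrr.
pose S N := q * \sum_(d < N) e ^+ d.
have SE N j k : (j + k < N)%N -> pcoef (S N) j k = pcoef (S (j + k).+1) j k.
  move=> h; rewrite /S /pcoef !coefCM !coef_sum; congr (_ * _).
  apply: (@sum_ord_trunc _ (fun d => ((e ^+ d)`_k)`_j)) => // d hd.
  exact: pcoef_expr.
exists (fun j k => pcoef (S (j + k).+1) j k); apply: arrP => j k.
transitivity (pcoef (P * S (j + k).+1) j k).
  rewrite -conv_pcoef; apply: conv_local => // i l hi hl.
  by rewrite -(SE (j + k).+1) // ltnS leq_add.
have -> : P * S (j + k).+1 = 1 - e ^+ (j + k).+1.
  rewrite /S mulrA -[1 in RHS](expr1n _ (j + k).+1) subrXX.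
  rewrite (_ : P * q = 1 - e); last by rewrite /e opprB addrCA subrr addr0 mulrC.
  congr (_ * _); by apply: eq_bigr => d _; rewrite expr1n mul1r.
by have := pcoef_expr e0 (ltnSn (j + k)); rewrite /pcoef !coefB => ->; rewrite subr0.
Qed.

(** * One-variable estimates *)

Implicit Types u v : nat -> C.

(** Multiplication of a one-variable power series by a polynomial. *)
Definition act q u : nat -> C := fun d => \sum_(e < d.+1) q`_e * u (d - e)%N.

(** Partial sums of the squared norm: estimates at every cut-off apply to series not yet known to be
    square summable. *)
Definition energy (L : nat) u : R := \sum_(d < L) normsq (u d).

Definition prev u : nat -> C := fun d => if d is d'.+1 then u d' else 0.

Lemma act_poly N q u d : (d < N)%N -> act q u d = (q * \poly_(e < N) u e)`_d.
Proof.
move=> hd; rewrite coefM; apply: eq_bigr => e _.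
by rewrite coef_poly (leq_ltn_trans (leq_subr _ _) hd).
Qed.

Lemma act_mul q1 q2 u : act (q1 * q2) u = act q1 (act q2 u).
Proof.
apply/funext => d; rewrite (act_poly _ _ (ltnSn d)) -mulrA coefM.
by apply: eq_bigr => e _; rewrite -act_poly // ltnS leq_subr.
Qed.

Lemma act1 u : act 1 u = u.
Proof.
apply/funext => d; rewrite (act_poly _ _ (ltnSn d)) mul1r coef_poly.
by rewrite ltnSn.
Qed.

Lemma act_lin (s t : C) u d : act (s%:P + t *: 'X) u d = s * u d + t * prev u d.
Proof.
rewrite (act_poly _ _ (ltnSn d)) mulrDl coefD coefCM -scalerAl coefZ coefXM.
rewrite coef_poly ltnSn; case: d => [|d] //=.
by rewrite coef_poly ltnS leqnSn.
Qed.

Lemma act_scale (s : C) q u d : act (s *: q) u d = s * act q u d.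
Proof.
by rewrite /act mulr_sumr; apply: eq_bigr => e _; rewrite coefZ mulrA.
Qed.

Lemma energy_ge0 L u : 0 <= energy L u.
Proof. by apply: sumr_ge0 => d _; apply: normsq_ge0. Qed.

Lemma energy_scale L (s : C) u : energy L (fun d => s * u d) = normsq s * energy L u.
Proof. by rewrite /energy mulr_sumr; apply: eq_bigr => d _; rewrite normsqM. Qed.

Lemma energy_act_scale L (s : C) q u :
  energy L (act (s *: q) u) = normsq s * energy L (act q u).
Proof. by rewrite -energy_scale; congr energy; apply/funext => d; apply: act_scale. Qed.

Lemma energy_prev L u : energy L u = energy L (prev u) + normsq (prev u L).
Proof.
elim: L => [|L IH]; first by rewrite /energy !big_ord0 normsq0 addr0.
by rewrite /energy !big_ord_recr /= -!/(energy _ _) IH.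
Qed.

Lemma energy_prev_le L u : energy L (prev u) <= energy L u.
Proof. by rewrite (energy_prev L u) lerDl normsq_ge0. Qed.

(* Summed over [d], the pointwise identity telescopes. *)
Lemma energy_blaschke L (s : C) u : normsq s <= 1 ->
  energy L (act ((- conjc s)%:P + 1 *: 'X) u) <= energy L (act (1%:P + (- s) *: 'X) u).
Proof.
move=> hs; rewrite -subr_ge0 /energy -sumrB.
rewrite (_ : \sum_(i < L) _ = (1 - normsq s) * (energy L u - energy L (prev u))).
  by rewrite mulr_ge0 ?subr_ge0 // energy_prev_le.
rewrite /energy -sumrB mulr_sumr; apply: eq_bigr => d _; rewrite !act_lin.
move: (u d) (prev u d) {hs} => [v1 v2] [w1 w2]; case: s => s1 s2.
by rewrite /normsq /=; ring.
Qed.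

(** The variance identity for the values [v] and [v - w] with weights [1 - r] and [r], whose mean is
    [v - r w]. *)
Lemma normsq_dilate (r : R) (v w : C) :
  (1 - r) * normsq v + r * normsq (v - w)
  = normsq (v - Complex r 0 * w) + r * (1 - r) * normsq w.
Proof. by case: v w => [v1 v2] [w1 w2]; rewrite /normsq /=; ring. Qed.

(** Sum [normsq_dilate] with [w = s * prev u] and bound the energy of [prev u] by that of [u]; the
    coefficient left is [(1 - r) - r (1 - r) = (1 - r) ^+ 2]. Dropping the first term on the left
    gives [energy_dilate], dropping the second gives [energy_resolvent]. *)
Lemma energy_dilate_sum L (r : R) (s : C) u : normsq s <= 1 -> 0 <= r <= 1 ->
  (1 - r) ^+ 2 * energy L u + r * energy L (act (1%:P + (- s) *: 'X) u)
  <= energy L (act (1%:P + (- (Complex r 0 * s)) *: 'X) u).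
Proof.
move=> hs /andP[r0 r1].
have e d : r * normsq (act (1%:P + (- s) *: 'X) u d) =
    normsq (act (1%:P + (- (Complex r 0 * s)) *: 'X) u d)
    + r * (1 - r) * (normsq s * normsq (prev u d)) - (1 - r) * normsq (u d).
  rewrite !act_lin !mul1r !mulNr -[_ * s * _]mulrA -normsqM.
  by have := normsq_dilate r (u d) (s * prev u d); lra.
have -> : r * energy L (act (1%:P + (- s) *: 'X) u) =
    energy L (act (1%:P + (- (Complex r 0 * s)) *: 'X) u)
    + r * (1 - r) * (normsq s * energy L (prev u)) - (1 - r) * energy L u.
  rewrite /energy !mulr_sumr -big_split -sumrB /=.
  by apply: eq_bigr => d _; rewrite e.
have h1 : normsq s * energy L (prev u) <= energy L u.
  apply: le_trans (energy_prev_le L u).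
  by rewrite ler_piMl ?energy_ge0.
have h2 : r * (1 - r) * (normsq s * energy L (prev u)) <= r * (1 - r) * energy L u.
  by rewrite ler_wpM2l // mulr_ge0 // subr_ge0.
by lra.
Qed.

Lemma energy_dilate L (r : R) (s : C) u : normsq s <= 1 -> 2^-1 <= r <= 1 ->
  energy L (act (1%:P + (- s) *: 'X) u)
  <= 2 * energy L (act (1%:P + (- (Complex r 0 * s)) *: 'X) u).
Proof.
move=> hs /andP[r0 r1].
have hr : 0 <= r <= 1 by rewrite r1 andbT; apply: le_trans r0; rewrite invr_ge0.
have := energy_dilate_sum L u hs hr.
have := energy_ge0 L u; have := energy_ge0 L (act (1%:P + (- s) *: 'X) u).
by have := sqr_ge0 (1 - r); nra.
Qed.

Lemma energy_resolvent L (r : R) (s : C) u : normsq s <= 1 -> 0 <= r < 1 ->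
  energy L (act 1 u) <= ((1 - r) ^+ 2)^-1 *
    energy L (act (1%:P + (- (Complex r 0 * s)) *: 'X) u).
Proof.
move=> hs /andP[r0 r1]; have hr : 0 <= r <= 1 by rewrite r0 ltW.
have p : 0 < (1 - r) ^+ 2 by rewrite exprn_gt0 // subr_gt0.
rewrite act1 ler_pdivlMl //; apply: le_trans (energy_dilate_sum L u hs hr).
by rewrite lerDl mulr_ge0 // energy_ge0.
Qed.

(** Factors are exchanged one at a time: [B s] commutes with the remaining factors and is absorbed
    into the series, which is why [u] is general in the induction. *)
Lemma energy_prod L (K : R) (A B : C -> {poly C}) (S : seq C) u : 0 <= K ->
  (forall s v, s \in S -> energy L (act (A s) v) <= K * energy L (act (B s) v)) ->
  energy L (act (\prod_(s <- S) A s) u)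
  <= K ^+ size S * energy L (act (\prod_(s <- S) B s) u).
Proof.
move=> K0; elim: S u => [|s S IH] u h; first by rewrite !big_nil expr0 mul1r.
rewrite !big_cons act_mul; apply: le_trans (h _ _ (mem_head _ _)) _.
rewrite /= exprS -mulrA ler_wpM2l // -act_mul !(mulrC (B s)) !act_mul.
apply: IH => s' v hs'.
by apply: h; rewrite inE hs' orbT.
Qed.

(** The [s] are the reciprocals of the roots, padded with zeros up to the formal degree [D]; the
    padding makes reflection at degree [D] act factor by factor in [polyrev_prod]. *)
Lemma poly_factor q D : (size q <= D.+1)%N -> q.[0] != 0 ->
  exists S : seq C, [/\ size S = D, q = q.[0] *: \prod_(s <- S) (1%:P + (- s) *: 'X) &
    forall s, s \in S -> s = 0 \/ root q s^-1].
Proof.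
move=> hD q0; have [rs hq] := closed_field_poly_normal q.
have nq : q != 0 by apply: contra q0 => /eqP ->; rewrite horner0.
have lc : lead_coef q != 0 by rewrite lead_coef_eq0.
have rq z : z \in rs -> root q z.
  by move=> hz; rewrite hq rootZ // root_prod_XsubC.
have z0 z : z \in rs -> z != 0.
  by move=> /rq; apply: contraTneq => ->; rewrite rootE.
have szr : (size rs <= D)%N.
  by rewrite -ltnS; apply: leq_trans hD; rewrite hq size_scale // size_prod_XsubC.
pose F (s : C) : {poly C} := 1%:P + (- s) *: 'X.
have F0 k : \prod_(s <- nseq k 0) F s = 1.
  by apply: big1_seq => s /andP[_ /nseqP[-> _]]; rewrite /F oppr0 scale0r addr0.
pose S := [seq z^-1 | z <- rs] ++ nseq (D - size rs) 0.
have e : \prod_(z <- rs) ('X - z%:P) = (\prod_(z <- rs) - z) *: \prod_(s <- S) F s.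
  rewrite big_cat /= F0 mulr1 big_map -scaler_prod /= big_seq [RHS]big_seq.
  apply: eq_bigr => z /z0 hz; rewrite /F scalerDr scalerA mulrNN mulfV // scale1r.
  by rewrite scale_polyC mulr1 addrC polyCN.
have Fh : (\prod_(s <- S) F s).[0] = 1.
  by rewrite horner_prod big1 // => s _; rewrite !hornerE.
exists S; split; first by rewrite size_cat size_map size_nseq subnKC.
  by rewrite hq e scalerA !hornerZ Fh mulr1.
move=> s; rewrite mem_cat => /orP[/mapP[z hz ->]|/nseqP[-> _]]; last by left.
by right; rewrite invrK; apply: rq.
Qed.

(** The one-variable reflection [t^D conj q(1 / conj t)]. *)
Definition polyrev (D : nat) q : {poly C} := \poly_(d < D.+1) conjc q`_(D - d).

Lemma coef_lin_mul (s t : C) q d :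
  ((s%:P + t *: 'X) * q)`_d = s * q`_d + t * (if d is d'.+1 then q`_d' else 0).
Proof. by rewrite mulrDl coefD coefCM -scalerAl coefZ coefXM; case: d. Qed.

Lemma size_lin_prod (S : seq C) :
  (size (\prod_(s <- S) (1%:P + (- s) *: 'X) : {poly C})%R <= (size S).+1)%N.
Proof.
elim: S => [|s S IH]; first by rewrite big_nil size_poly1.
rewrite big_cons; apply/leq_sizeP => j hj; rewrite coef_lin_mul.
case: j hj => // j hj; rewrite !nth_default ?mulr0 ?addr0 //;
  by apply: leq_trans IH _; rewrite // ltnW.
Qed.

(** A factor [1 - s t] reflects to [t - conj s], the pair being denominator and numerator of a
    Blaschke factor. *)
Lemma polyrev_prod (S : seq C) :
  polyrev (size S) (\prod_(s <- S) (1%:P + (- s) *: 'X))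
  = \prod_(s <- S) ((- conjc s)%:P + 1 *: 'X).
Proof.
elim: S => [|s S IH].
  rewrite !big_nil /polyrev; apply/polyP => -[|d].
    by rewrite coef_poly subnn !coef1; exact: conjc1.
  by rewrite coef_poly /= coef1.
rewrite !big_cons -IH; have := size_lin_prod S.
set q := \prod_(j <- S) _; move=> hq; apply/polyP => d.
rewrite coef_lin_mul coef_poly coef_lin_mul /=.
have hz : q`_(size S).+1 = 0 by rewrite nth_default.
case: d => [|d].
  rewrite /polyrev coef_poly subn0 hz /= subn0.
  by rewrite !mulr0 add0r addr0 rmorphM rmorphN.
rewrite /polyrev !coef_poly !ltnS subSS; case: ltngtP => hd.
- by rewrite -(subnSK hd) rmorphD !rmorphM rmorphN rmorph1 !mul1r addrC.
- by rewrite mulr0 mulr0 addr0.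
- by rewrite hd subnn mulr0 addr0 mulr0 add0r !mul1r.
Qed.

Lemma comp_scaleX_coef q (r : C) d : (q \Po (r *: 'X))`_d = r ^+ d * q`_d.
Proof.
rewrite comp_polyE coef_sum; under eq_bigr do rewrite exprZn coefZ coefZ coefXn.
have [hd|hd] := ltnP d (size q); last first.
  rewrite (nth_default _ hd) mulr0 big1 // => i _.
  by rewrite (gtn_eqF (leq_trans (ltn_ord i) hd)) !mulr0.
rewrite (bigD1 (Ordinal hd)) //= eqxx mulr1 mulrC big1 ?addr0 // => i ne.
by rewrite eq_sym (_ : (_ == _) = false) ?mulr0 //; apply/eqP => e; case/eqP: ne; apply/val_inj.
Qed.

Lemma comp_lin_prod (S : seq C) (r : C) :
  (\prod_(s <- S) (1%:P + (- s) *: 'X)) \Po (r *: 'X)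
  = \prod_(s <- S) (1%:P + (- (r * s)) *: 'X) :> {poly C}.
Proof.
rewrite rmorph_prod; apply: eq_bigr => s _ /=.
by rewrite comp_polyD comp_polyC comp_polyZ comp_polyX scalerA mulNr mulrC.
Qed.

(** * Slices [z = (t, om t)] and averages over [om] *)

(** The coefficients in [t] of [a(t, om t)]: terms of equal total degree are collected, so each
    coefficient is a finite sum. *)
Definition slice (om : C) a : nat -> C :=
  fun d => \sum_(k < d.+1) om ^+ k * a (d - k)%N k.

Lemma slice_pcoef om P d : (P.[om *: 'X])`_d = slice om (pcoef P) d.
Proof.
pose F k := om ^+ k * (if (k <= d)%N then (P`_k)`_(d - k) else 0).
transitivity (\sum_(k < size P) F k).
  rewrite horner_coef coef_sum; apply: eq_bigr => k _.
  rewrite exprZn -scalerAr coefZ coefMXn /F ltnNge; by case: (k <= d)%N.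
transitivity (\sum_(k < maxn (size P) d.+1) F k).
  apply/esym/sum_ord_trunc; last exact: leq_maxl.
  by move=> k hk; rewrite /F (_ : P`_k = 0) ?coef0 ?if_same ?mulr0 // nth_default.
rewrite (@sum_ord_trunc _ F d.+1); last exact: leq_maxr.
  by apply: eq_bigr => -[k hk] _; rewrite /F /= -ltnS hk.
by move=> k hk; rewrite /F leqNgt hk mulr0.
Qed.

Lemma slice_local om a b d :
  (forall j k, (j <= d)%N -> (k <= d)%N -> a j k = b j k) ->
  slice om a d = slice om b d.
Proof.
by move=> h; apply: eq_bigr => k _; rewrite h ?leq_subr // -ltnS.
Qed.

Lemma slice_conv om P a : slice om (conv (pcoef P) a) = act P.[om *: 'X] (slice om a).
Proof.
apply/funext => d.
rewrite (@slice_local _ _ (pcoef (P * trunc d.+1 a))); last first.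
  move=> j k hj hk; rewrite -conv_pcoef; apply: conv_local => // i l hi hl.
  by rewrite pcoef_trunc // ltnS ?(leq_trans hi) ?(leq_trans hl).
rewrite -slice_pcoef hornerM coefM; apply: eq_bigr => e _; congr (_ * _).
rewrite slice_pcoef; apply: slice_local => j k hj hk.
by rewrite pcoef_trunc // ltnS ?(leq_trans hj) ?(leq_trans hk) // leq_subr.
Qed.

Lemma prim_root_exists (N : nat) : (0 < N)%N -> exists z : C, N.-primitive_root z.
Proof.
move=> N0; have [r Dp] := closed_field_poly_normal ('X^N - 1 : {poly C}).
rewrite (monicP _) ?monicXnsubC // scale1r in Dp.
have rn1 : all N.-unity_root r.
  by apply/allP => z; rewrite -root_prod_XsubC -Dp.
have sz : (N < (size r).+1)%N by rewrite -(size_prod_XsubC r id) -Dp size_XnsubC.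
have [|z _ hz] := hasP (has_prim_root N0 rn1 _ sz); last by exists z.
by rewrite -separable_prod_XsubC -Dp separable_Xn_sub_1 // pnatr_eq0 -lt0n.
Qed.

Lemma unity_normsq (z : C) N : (0 < N)%N -> z ^+ N = 1 -> normsq z = 1.
Proof.
move=> N0 h; have : normsq (z ^+ N) = normsq 1 by rewrite h.
rewrite normsqX normsq1 => /eqP.
by rewrite pexpr_eq1 ?normsq_ge0 // => /eqP.
Qed.

Lemma unity_conj (z : C) : normsq z = 1 -> conjc z = z^-1.
Proof.
move=> h; have e : z * conjc z = 1 by rewrite mulcJ h.
have z0 : z != 0.
  by apply/eqP => z0; move: e; rewrite z0 mul0r => /eqP; rewrite eq_sym oner_eq0.
by apply: (mulfI z0); rewrite e mulfV.
Qed.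

(** Orthogonality of the characters of the [N]-th roots of unity; [d < N] keeps the powers [z ^+ k]
    with [k <= d] distinct. *)
Lemma parseval N (z : C) (F : nat -> C) d : N.-primitive_root z -> (d < N)%N ->
  \sum_(i < N) normsq (\sum_(k < d.+1) (z ^+ i) ^+ k * F k)
  = N%:R * \sum_(k < d.+1) normsq (F k).
Proof.
move=> hz hd; have N0 : (0 < N)%N by apply: leq_ltn_trans hd.
have cz : conjc z = z^-1 by apply/unity_conj/(unity_normsq N0); apply: prim_expr_order.
have z0 : z != 0.
  apply/eqP => z0; have := prim_expr_order hz; rewrite z0 expr0n eqn0Ngt N0.
  by move=> /eqP; rewrite eq_sym oner_eq0.
have orth (k l : 'I_d.+1) : \sum_(i < N) (z ^+ k / z ^+ l) ^+ i = N%:R *+ (k == l).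
  have [->|ne] := eqVneq k l.
    rewrite mulr1n divff ?expf_neq0 //.
    under eq_bigr do rewrite expr1n.
    by rewrite sumr_const card_ord.
  set y := _ / _; rewrite mulr0n; have yN : y ^+ N = 1.
    by rewrite /y expr_div_n ![_ ^+ _ ^+ N]exprAC (prim_expr_order hz) !expr1n divr1.
  have y1 : y - 1 != 0.
    rewrite subr_eq0 /y; apply: contra ne => /eqP /divr1_eq /eqP.
    rewrite (eq_prim_root_expr hz) !modn_small ?(leq_trans (ltn_ord _)) //.
  by apply: (mulfI y1); rewrite mulr0 -subrX1 yN subrr.
apply: (@complexI R); rewrite rmorph_sum rmorphM rmorph_sum rmorph_nat /=.
have E (x : C) : (normsq x)%:C%C = x * conjc x by rewrite mulcJ.
transitivity (\sum_(i < N) \sum_(k < d.+1) \sum_(l < d.+1)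
   (F k * conjc (F l)) * (z ^+ k / z ^+ l) ^+ i).
  apply: eq_bigr => i _; rewrite E rmorph_sum mulr_suml; apply: eq_bigr => k _.
  rewrite mulr_sumr; apply: eq_bigr => l _.
  rewrite rmorphM !rmorphXn /= cz -!exprM !exprVn expr_div_n -!exprM (mulnC k) (mulnC l).
  by rewrite mulrACA [RHS]mulrC.
rewrite exchange_big mulr_sumr; apply: eq_bigr => k _.
rewrite exchange_big (bigD1 k) //= [X in _ + X]big1 ?addr0.
  by rewrite -mulr_sumr orth eqxx mulr1n E mulrC.
by move=> l ne; rewrite -mulr_sumr orth eq_sym (negbTE ne) mulr0.
Qed.

Definition trisum (L : nat) a : R := \sum_(d < L) \sum_(k < d.+1) normsq (a (d - k)%N k).

(** One root of unity of order above every degree below [L] serves all arrays at once, so a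
    comparison of two arrays can be averaged. *)
Lemma energy_average L : exists N (z : C), [/\ (0 < N)%N, z ^+ N = 1 &
  forall a, \sum_(i < N) energy L (slice (z ^+ i) a) = N%:R * trisum L a].
Proof.
have [z hz] := prim_root_exists (ltn0Sn L); exists L.+1, z.
split=> //; first exact: prim_expr_order.
move=> a; rewrite exchange_big mulr_sumr; apply: eq_bigr => d _.
by apply: (parseval (fun k => a (d - k)%N k) hz); apply: leq_trans (ltn_ord d) _.
Qed.

Lemma trisum_le L (K : R) a b :
  (forall om, normsq om = 1 -> energy L (slice om a) <= K * energy L (slice om b)) ->
  trisum L a <= K * trisum L b.
Proof.
move=> h; have [N [z [N0 zN hN]]] := energy_average L.
have Np : 0 < N%:R :> R by rewrite ltr0n.
rewrite -(ler_pM2l Np) mulrCA -!hN mulr_sumr; apply: ler_sum => i _; apply: h.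
by rewrite normsqX (unity_normsq N0 zN) expr1n.
Qed.

Lemma trisumE L a : trisum L a = \sum_(k < L) \sum_(j < L - k) normsq (a j k).
Proof.
transitivity (\sum_(d < L) \sum_(k < L) if (k <= d)%N then normsq (a (d - k)%N k) else 0).
  apply: eq_bigr => d _.
  rewrite (@sum_ord_trunc _ (fun k => if (k <= d)%N then normsq (a (d - k)%N k) else 0) d.+1) //.
    by apply: eq_bigr => -[k hk] _ /=; rewrite -ltnS hk.
  by move=> k hk; rewrite leqNgt hk.
rewrite exchange_big; apply: eq_bigr => k _.
rewrite -(big_mkord xpredT (fun d => if (k <= d)%N then normsq (a (d - k)%N k) else 0)).
rewrite (big_cat_nat (leq0n k) (ltnW (ltn_ord k))) /= [X in X + _]big_nat big1 ?add0r.
  by rewrite -{1}(add0n (k : nat)) big_addn big_mkord; apply: eq_bigr => j _; rewrite leq_addl addnK.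
by move=> d /andP[_ hd]; rewrite leqNgt hd.
Qed.

Lemma trisum_le_square L a : trisum L a <= squaresum (fun j k => normsq (a j k)) L.
Proof.
rewrite trisumE /squaresum exchange_big; apply: ler_sum => k _.
rewrite -!(big_mkord xpredT (fun j => normsq (a j k))).
rewrite [leRHS](big_cat_nat (leq0n (L - k)) (leq_subr k L)) /= lerDl sumr_ge0 // => j _.
exact: normsq_ge0.
Qed.

Lemma square_le_trisum N a :
  squaresum (fun j k => normsq (a j k)) N <= trisum (N + N) a.
Proof.
rewrite trisumE /squaresum exchange_big big_split_ord /= -[leLHS]addr0; apply: lerD.
  apply: ler_sum => k _; rewrite -!(big_mkord xpredT (fun j => normsq (a j k))).
  have hk : (N <= N + N - k)%N by rewrite -addnBA ?leq_addr // ltnW.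
  by rewrite [leRHS](big_cat_nat (leq0n N) hk) /= lerDl sumr_ge0 // => j _; apply: normsq_ge0.
by apply: sumr_ge0 => k _; apply: sumr_ge0 => j _; apply: normsq_ge0.
Qed.

(** A triangle of side [L] lies in the square of side [L], and a square of side [N] in the triangle
    of side [N + N], so triangular bounds control the norm. *)
Lemma H2_trisum_le (K : R) a b : 0 <= K ->
  (forall L, trisum L a <= K * trisum L b) -> H2 b -> H2 a /\ nsq a <= K * nsq b.
Proof.
move=> K0 h hb; have hN N : squaresum (fun j k => normsq (a j k)) N <= K * nsq b.
  apply: le_trans (square_le_trisum _ _) (le_trans (h _) _); rewrite ler_wpM2l //.
  exact: le_trans (trisum_le_square _ _) (squaresum_le_nsq _ hb).
by split; [apply: H2_bound hN | apply: nsq_le hN].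
Qed.

(** * Multiplication by [p~ / p] and by [p(z) / p(r z)] *)

Lemma peval_slice om P z : (P.[om *: 'X]).[z] = peval P z (om * z).
Proof.
rewrite /peval !(horner_coef P) !horner_sum; apply: eq_bigr => k _.
by rewrite !hornerM !horner_exp hornerZ hornerX hornerC.
Qed.

Lemma pcoef_bideg1 m n P j k : bideg_le m n P -> (m < j)%N -> pcoef P j k = 0.
Proof. by move=> [_ h] hj; rewrite /pcoef nth_default // (leq_trans (h k)). Qed.

Lemma pcoef_bideg2 m n P j k : bideg_le m n P -> (n < k)%N -> pcoef P j k = 0.
Proof.
by move=> [h _] hk; rewrite /pcoef (_ : P`_k = 0) ?coef0 // nth_default // (leq_trans h).
Qed.

Lemma size_slice m n om P : bideg_le m n P -> (size P.[om *: 'X] <= (m + n).+1)%N.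
Proof.
move=> h; apply/leq_sizeP => d hd; rewrite slice_pcoef /slice big1 // => k _.
have [hk|hk] := ltnP n k; first by rewrite (pcoef_bideg2 _ h) ?mulr0.
by rewrite (pcoef_bideg1 _ h) ?mulr0 //; lia.
Qed.

(** For nonzero [s] the point [(s^-1, om s^-1)] is a zero of [P], so it lies outside the bidisk and
    [s] has modulus at most 1. *)
Lemma slice_factor m n P om : bideg_le m n P ->
  (forall z1 z2, normc z1 < 1 -> normc z2 < 1 -> peval P z1 z2 != 0) ->
  normsq om = 1 ->
  exists S : seq C, [/\ size S = (m + n)%N,
    P.[om *: 'X] = pcoef P 0 0 *: \prod_(s <- S) (1%:P + (- s) *: 'X) &
    forall s, s \in S -> normsq s <= 1].
Proof.
move=> hb nz om1.
have h0 : (P.[om *: 'X]).[0] = pcoef P 0 0.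
  by rewrite horner_coef0 slice_pcoef /slice big_ord_recl big_ord0 addr0 expr0 mul1r.
have n0 : normc 0 < 1 by rewrite ComplexField.Normc.normc0.
have q0 : (P.[om *: 'X]).[0] != 0 by rewrite peval_slice mulr0; apply: nz.
have [S [sS qS rS]] := poly_factor (size_slice om hb) q0.
exists S; split=> //; first by rewrite -h0.
move=> s /rS[->|]; first by rewrite normsq0.
rewrite rootE peval_slice => /eqP rs; rewrite leNgt; apply/negP => s1.
have hs : normc s^-1 < 1.
  rewrite -(@ltr_pXn2r _ 2) ?nnegrE ?normc_ge0 // expr1n normc_sq.
  rewrite -normc_sq ComplexField.Normc.normcV exprVn normc_sq invf_lt1 //.
  exact: lt_trans s1.
have ho : normc (om * s^-1) < 1.
  suff -> : normc (om * s^-1) = normc s^-1 by [].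
  rewrite ComplexField.Normc.normcM (_ : normc om = 1) ?mul1r //.
  by apply/eqP; rewrite -(@eqrXn2 _ 2) ?normc_ge0 // normc_sq om1 expr1n.
by have := nz _ _ hs ho; rewrite rs eqxx.
Qed.

Lemma pcoef_prefl m n P j k :
  pcoef (prefl m n P) j k =
  if (j <= m)%N && (k <= n)%N then conjc (pcoef P (m - j)%N (n - k)%N) else 0.
Proof.
rewrite /pcoef /prefl coef_poly ltnS; case: (k <= n)%N; rewrite ?andbF ?andbT.
  by rewrite coef_poly ltnS.
by rewrite coef0.
Qed.

Lemma bideg_prefl m n P : bideg_le m n (prefl m n P).
Proof.
split; first exact: size_poly.
move=> k; apply/leq_sizeP => j hj; rewrite -[LHS]/(pcoef _ j k) pcoef_prefl.
by rewrite leqNgt hj.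
Qed.

(** For [|om| = 1] one has [1 / conj (om t) = om / conj t], so reflection commutes with slicing up
    to [om ^+ n]. *)
Lemma slice_prefl m n P om : bideg_le m n P -> normsq om = 1 ->
  (prefl m n P).[om *: 'X] = om ^+ n *: polyrev (m + n) P.[om *: 'X].
Proof.
move=> hb om1; have om0 : om != 0.
  by apply/eqP => e; move: om1; rewrite e normsq0 => /eqP; rewrite eq_sym oner_eq0.
have ext Q e : bideg_le m n Q -> slice om (pcoef Q) e =
    \sum_(k < n.+1) om ^+ k * (if (k <= e)%N then pcoef Q (e - k)%N k else 0).
  move=> hQ; pose F k := om ^+ k * (if (k <= e)%N then pcoef Q (e - k)%N k else 0).
  transitivity (\sum_(k < maxn n.+1 e.+1) F k).
    rewrite (@sum_ord_trunc _ F e.+1) ?leq_maxr //.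
      by apply: eq_bigr => -[k hk] _; rewrite /F /= -ltnS hk.
    by move=> k hk; rewrite /F leqNgt hk mulr0.
  rewrite (@sum_ord_trunc _ F n.+1) ?leq_maxl // => k hk.
  by rewrite /F (pcoef_bideg2 _ hQ) // if_same mulr0.
apply/polyP => d; rewrite slice_pcoef coefZ coef_poly ext; last exact: bideg_prefl.
case: ifP => hd; last first.
  rewrite mulr0; apply: big1 => -[k hk] _ /=; rewrite pcoef_prefl.
  have [hkd|hkd] := leqP k d; last by rewrite mulr0.
  by rewrite (_ : (d - k <= m)%N = false) ?mulr0 //; lia.
rewrite slice_pcoef ext // rmorph_sum mulr_sumr (reindex_inj rev_ord_inj) /=.
apply: eq_bigr => -[k hk] _ /=; rewrite subSS pcoef_prefl.
rewrite rmorphM rmorphXn /= (unity_conj om1) mulrA exprVn -expfB_cond; last first.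
  by rewrite (negbTE om0) add0n -ltnS.
congr (_ * _); rewrite leq_subr andbT subKn //.
have [h1|h1] := leqP (n - k) d.
- have [h2|h2] := leqP (d - (n - k)) m.
    rewrite (_ : (k <= m + n - d)%N = true); last by lia.
    by congr (conjc (pcoef _ _ _)); lia.
  by rewrite (_ : (k <= m + n - d)%N = false) ?conjc0 //; lia.
- case: ifP => _; last by rewrite conjc0.
  by rewrite (pcoef_bideg1 _ hb) ?conjc0 //; lia.
Qed.

Definition pdil (r : C) P : {poly {poly C}} :=
  \poly_(k < size P) \poly_(j < size P`_k) (r ^+ (j + k) * (P`_k)`_j).

Lemma pcoef_pdil r P j k : pcoef (pdil r P) j k = r ^+ (j + k) * pcoef P j k.
Proof.
rewrite /pcoef coef_poly; case: ltnP => hk; last first.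
  by rewrite (_ : P`_k = 0) ?coef0 ?mulr0 // nth_default.
by rewrite coef_poly; case: ltnP => // hj; rewrite [X in _ * X]nth_default // mulr0.
Qed.

Lemma slice_pdil r P om : (pdil r P).[om *: 'X] = P.[om *: 'X] \Po (r *: 'X).
Proof.
apply/polyP => d; rewrite comp_scaleX_coef !slice_pcoef mulr_sumr.
apply: eq_bigr => -[k hk] _ /=; rewrite pcoef_pdil subnK //.
by rewrite mulrCA.
Qed.

Section Zerofree.
Variables (m n : nat) (p : {poly {poly C}}).
Hypothesis bp : bideg_le m n p.
Hypothesis nzp : forall z1 z2, normc z1 < 1 -> normc z2 < 1 -> peval p z1 z2 != 0.

Lemma pcoef00_neq0 : pcoef p 0 0 != 0.
Proof.
have h : peval p 0 0 = pcoef p 0 0 by rewrite /peval !horner_coef0.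
by rewrite -h nzp // ComplexField.Normc.normc0.
Qed.

(** The formal series [x] stands for [g / p] with [g] in [H2]: multiplication by [p~ / p] preserves
    [H2]. On slices this is [energy_blaschke] factor by factor. *)
Lemma theta_H2 x : H2 (conv (pcoef p) x) -> H2 (conv (pcoef (prefl m n p)) x).
Proof.
move=> h; have [] // := @H2_trisum_le 1 (conv (pcoef (prefl m n p)) x) _ _ _ h.
move=> L; apply: trisum_le => om om1; rewrite !slice_conv (slice_prefl bp om1).
have [S [sS -> hS]] := slice_factor bp nzp om1.
have -> T : polyrev (m + n) (pcoef p 0 0 *: T) = conjc (pcoef p 0 0) *: polyrev (m + n) T.
  apply/polyP => d; rewrite coefZ !coef_poly coefZ; case: ifP => _; last by rewrite mulr0.
  by rewrite rmorphM.
rewrite -sS polyrev_prod scalerA !energy_act_scale normsqM normsqX om1 expr1n mul1r.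
rewrite normsqJ mul1r ler_wpM2l ?normsq_ge0 //.
rewrite -[leRHS]mul1r -(expr1n R (size S)); apply: energy_prod => //.
by move=> s v /hS hs; rewrite mul1r; apply: energy_blaschke.
Qed.

(** Multiplication by [p(z) / p(r z)] is bounded uniformly in [r]: on a slice each of the [m + n]
    linear factors costs 2. *)
Lemma dilation_bound (r : R) x : 2^-1 <= r <= 1 ->
  H2 (conv (pcoef (pdil (Complex r 0) p)) x) ->
  H2 (conv (pcoef p) x) /\
  nsq (conv (pcoef p) x) <= 2 ^+ (m + n) * nsq (conv (pcoef (pdil (Complex r 0) p)) x).
Proof.
move=> hr; apply: H2_trisum_le; first exact: exprn_ge0.
move=> L; apply: trisum_le => om om1; rewrite !slice_conv slice_pdil.
have [S [sS -> hS]] := slice_factor bp nzp om1.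
rewrite comp_polyZ comp_lin_prod !energy_act_scale mulrCA ler_wpM2l ?normsq_ge0 //.
rewrite -sS; apply: energy_prod => // s v /hS hs; exact: energy_dilate.
Qed.

(** For fixed [r < 1] division by [p(r z)] is bounded with a constant [K] depending on [r]; only
    membership in [H2] is kept. *)
Lemma dilation_H2 (r : R) x : 0 <= r < 1 ->
  H2 (conv (pcoef (pdil (Complex r 0) p)) x) -> H2 x.
Proof.
move=> hr h; pose K := (normsq (pcoef p 0 0))^-1 * ((1 - r) ^+ 2)^-1 ^+ (m + n).
have c0 : 0 < normsq (pcoef p 0 0).
  rewrite lt_neqAle normsq_ge0 andbT eq_sym; apply: contra pcoef00_neq0.
  by move=> /eqP/normsq_eq0 ->.
have K1 : 0 <= ((1 - r) ^+ 2)^-1 by rewrite invr_ge0 sqr_ge0.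
have K0 : 0 <= K by rewrite mulr_ge0 ?invr_ge0 ?normsq_ge0 // exprn_ge0.
have [] // := @H2_trisum_le K x _ K0 _ h.
move=> L; apply: trisum_le => om om1; rewrite slice_conv slice_pdil.
have [S [sS -> hS]] := slice_factor bp nzp om1.
rewrite comp_polyZ comp_lin_prod energy_act_scale /K.
rewrite [_^-1 * _ ^+ _]mulrC -mulrA mulKf ?gt_eqF // -sS.
have -> : energy L (slice om x) = energy L (act (\prod_(s <- S) 1) (slice om x)).
  by rewrite big1_eq act1.
apply: energy_prod => //.
by move=> s v /hS hs; apply: energy_resolvent.
Qed.

End Zerofree.

(** * The spaces [KTheta], [S1] and [S2] *)

Lemma squaresum_finsupp t N M : (forall j k, ~~ ((j < N) && (k < N))%N -> t j k = 0) ->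
  (N <= M)%N -> squaresum t M = squaresum t N.
Proof.
move=> h hM; rewrite /squaresum (@sum_ord_trunc _ (fun j => \sum_(k < M) t j k) N) //.
  apply: eq_bigr => j _; apply: sum_ord_trunc => // k hk.
  by rewrite h // negb_and -!leqNgt hk orbT.
by move=> j hj; apply: big1 => k _; rewrite h // negb_and -!leqNgt hj.
Qed.

Lemma dsum_finsupp t N : (forall j k, ~~ ((j < N) && (k < N))%N -> t j k = 0) ->
  dsum t = squaresum t N.
Proof.
move=> h; apply: dsum_uniq; apply: cvg_near_cst; exists N => // M /= hM.
exact: squaresum_finsupp.
Qed.

(** The constant function 1; pairing with it evaluates at the origin. *)
Definition delta0 : arr := fun j k => ((j == 0%N) && (k == 0%N))%:R.

Lemma delta0_eq0 j k : ~~ ((j < 1) && (k < 1))%N -> delta0 j k = 0.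
Proof. by rewrite !ltnS !leqn0 /delta0 => /negbTE ->. Qed.

Lemma H2_delta0 : H2 delta0.
Proof.
apply: (H2_bound (M := 1)) => N.
apply: (@le_trans _ _ (squaresum (fun j k => normsq (delta0 j k)) N.+1)).
  by apply: squaresum_mono => // j k; apply: normsq_ge0.
rewrite (@squaresum_finsupp _ 1) //; last by move=> j k /delta0_eq0 ->; apply: normsq0.
by rewrite /squaresum !big_ord1 /delta0 normsq1.
Qed.

Lemma ip_delta0 a : ip delta0 a = conjc (a 0%N 0%N).
Proof.
rewrite ipE !(@dsum_finsupp _ 1); last first.
- by move=> j k /delta0_eq0 ->; rewrite mul0r.
- by move=> j k /delta0_eq0 ->; rewrite mul0r.
rewrite /squaresum !big_ord1 /delta0 /= mul1r; by case: (conjc _).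
Qed.

(** On the torus [conj p~] equals [conj (z1^m z2^n) p], so the adjoint of multiplication by [p~]
    multiplies by [p] and then shifts back [m] and [n] times. *)
Lemma adj_prefl m n P b : bideg_le m n P ->
  adj m n (prefl m n P) b = (fun j k => conv (pcoef P) b (m + j)%N (n + k)%N).
Proof.
move=> hP; apply: arrP => j k; rewrite (conv_bideg _ _ _ hP) /adj.
rewrite (reindex_inj rev_ord_inj); apply: eq_bigr => -[i hi] _ /=.
rewrite (reindex_inj rev_ord_inj); apply: eq_bigr => -[l hl] _ /=.
rewrite !subSS pcoef_prefl !leq_subr /= conjcK !subKn //; congr (_ * _).
rewrite iter_Mz1E iter_Mz2E (leq_trans _ (leq_addr _ _)) //.
by rewrite (leq_trans _ (leq_addr _ _)) //; congr b; lia.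
Qed.

Definition dil (r : C) a : arr := fun j k => r ^+ (j + k) * a j k.

Lemma conv_dil r a b : conv (dil r a) (dil r b) = dil r (conv a b).
Proof.
apply: arrP => j k; rewrite /dil mulr_sumr; apply: eq_bigr => -[i hi] _ /=.
rewrite mulr_sumr; apply: eq_bigr => -[l hl] _ /=.
rewrite mulrACA -exprD; congr (_ ^+ _ * _); lia.
Qed.

Lemma dil_pcoef r P : dil r (pcoef P) = pcoef (pdil r P).
Proof. by apply: arrP => j k; rewrite pcoef_pdil. Qed.

Lemma dil_one r : dil r (pcoef 1) = pcoef 1.
Proof.
apply: arrP => j k; rewrite /dil /pcoef coef1; case: k => [|k] /=; last first.
  by rewrite coef0 mulr0.
by rewrite coef1; case: j => [|j]; rewrite ?mulr0 ?expr0 ?mul1r.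
Qed.

Lemma normsq_expr_sub (r : R) d : 0 <= r <= 1 ->
  normsq (Complex r 0 ^+ d - 1) <= d%:R * (1 - r).
Proof.
move=> /andP[r0 r1]; have -> : Complex r 0 ^+ d = Complex (r ^+ d) 0.
  by rewrite -[LHS](rmorphXn (real_complex R)).
have h1 : 0 <= r ^+ d <= 1 by rewrite exprn_ge0 // exprn_ile1.
have h2 : 1 - r ^+ d <= d%:R * (1 - r).
  elim: d {h1} => [|d IH]; first by rewrite expr0 subrr mul0r.
  have h1 : 0 <= r ^+ d <= 1 by rewrite exprn_ge0 // exprn_ile1.
  by rewrite exprS -natr1; move/andP: h1 => [? ?]; nra.
rewrite /normsq /=; move/andP: h1 => [? ?]; nra.
Qed.

(** Each entry of the dilation error is bounded by a multiple of [1 - r] through [normsq_expr_sub],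
    and a coefficient of the product is a finite sum of such entries. *)
Lemma conv_dil_lip a b j k : exists2 M : R, 0 <= M &
  forall r : R, 0 <= r <= 1 ->
    normsq (conv b (arr_sub (dil (Complex r 0) a) a) j k) <= M * (1 - r).
Proof.
pose M := \sum_(i < j.+1) \sum_(l < k.+1) normsq (b i l) * normsq (a (j - i)%N (k - l)%N)
   * (j + k)%:R.
have Mi (i : 'I_j.+1) : 0 <= \sum_(l < k.+1)
    normsq (b i l) * normsq (a (j - i)%N (k - l)%N) * (j + k)%:R.
  by apply: sumr_ge0 => l _; rewrite !mulr_ge0 ?normsq_ge0.
exists (2 ^+ j.+1 * (2 ^+ k.+1 * M)) => [|r hr].
  by rewrite !mulr_ge0 ?exprn_ge0 ?sumr_ge0.
have r1 : 0 <= 1 - r by rewrite subr_ge0; case/andP: hr.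
have sz N : size (index_enum 'I_N) = N by rewrite -[RHS](card_ord N) cardE enumT.
apply: le_trans (normsq_sum_seq _ _) _; rewrite sz -!mulrA ler_wpM2l ?exprn_ge0 //.
rewrite mulrA mulr_sumr mulr_suml; apply: ler_sum => i _.
apply: le_trans (normsq_sum_seq _ _) _; rewrite sz -!mulrA ler_wpM2l ?exprn_ge0 //.
rewrite mulr_suml; apply: ler_sum => l _; rewrite normsqM -!mulrA ler_wpM2l ?normsq_ge0 //.
rewrite /arr_sub /dil -[X in _ * _ - X]mul1r -mulrBl normsqM mulrC ler_wpM2l ?normsq_ge0 //.
apply: le_trans (normsq_expr_sub _ hr) _; rewrite ler_wpM2r // ler_nat; lia.
Qed.

Definition cut (N : nat) a : arr := fun j k => if ((j < N) && (k < N))%N then a j k else 0.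

Lemma H2_cut N a : H2 a -> H2 (cut N a).
Proof.
move=> /H2P ha; apply/H2P; apply: dsummable_le ha => j k; rewrite /cut.
by case: ifP => _; rewrite ger0_norm ?normsq0 ?normsq_ge0.
Qed.

Lemma nsq_cut N a : nsq (cut N a) = squaresum (fun j k => normsq (a j k)) N.
Proof.
rewrite nsqE (@dsum_finsupp _ N) /cut => [|j k /negbTE ->]; last exact: normsq0.
by apply: eq_bigr => j _; apply: eq_bigr => k _; rewrite !ltn_ord.
Qed.

Lemma nsq_cut_compl N a : H2 a ->
  nsq (arr_sub a (cut N a)) = nsq a - squaresum (fun j k => normsq (a j k)) N.
Proof.
move=> ha; have h1 := nsq_summable (H2_sub ha (H2_cut N ha)).
have h2 := nsq_summable (H2_cut N ha).
rewrite -nsq_cut !nsqE; apply/eqP; rewrite eq_sym subr_eq; apply/eqP.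
rewrite -dsumD //; congr dsum; apply/funext => j; apply/funext => k.
by rewrite /arr_sub /cut; case: ifP => _; rewrite ?subrr ?subr0 normsq0 ?add0r ?addr0.
Qed.

Lemma nsq_cut_small a (e : R) : H2 a -> 0 < e ->
  exists N, nsq (arr_sub a (cut N a)) < e.
Proof.
move=> ha e0; have := squaresum_cvg (nsq_summable ha).
rewrite -nsqE => /cvgrPdist_lt /(_ e e0) [N _ /(_ N (leqnn N))] h.
exists N; rewrite nsq_cut_compl //; apply: le_lt_trans h; exact: ler_norm.
Qed.

Lemma ip_cut N a b : ip (cut N a) b = ip (cut N a) (cut N b).
Proof.
rewrite !ipE; congr Complex; congr dsum; apply/funext => j; apply/funext => k;
  by rewrite /cut; case: ifP => // _; rewrite !mul0r.
Qed.

Section Spaces.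
Variables (m n : nat) (p : {poly {poly C}}).
Hypothesis bp : bideg_le m n p.
Hypothesis nzp : forall z1 z2, normc z1 < 1 -> normc z2 < 1 -> peval p z1 z2 != 0.
Local Notation pt := (prefl m n p).
Let bpt : bideg_le m n pt := bideg_prefl m n p.

(** Test [h] against [p~ z1^j z2^k], which lies in [ThetaH2] with [f = p z1^j z2^k]; [adj_prefl]
    turns the pairing into this coefficient. *)
Lemma KTheta_conv h j k : KTheta p pt h -> conv (pcoef p) h (m + j)%N (n + k)%N = 0.
Proof.
move=> [hh K]; pose e := iter j (@Mz1 R) (iter k (@Mz2 R) delta0).
have he : H2 e by apply/H2_iterMz/H2_delta0.
have : ip h (conv (pcoef pt) e) = 0.
  apply: K; split; first exact: H2_conv bpt he.
  exists (conv (pcoef p) e); split; [exact: H2_conv bp he | exact: convCA].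
rewrite (ipC (H2_conv bpt he) hh) (ip_conv_adj bpt he hh).
rewrite ip_iter; [|exact: H2_delta0|exact: H2_adj].
by rewrite ip_delta0 conjcK (adj_prefl _ bp) !add0n.
Qed.

Lemma ip_conv_prefl k s : H2 k -> H2 s ->
  (forall i l, conv (pcoef p) k (m + i)%N (n + l)%N = 0) ->
  ip k (conv (pcoef pt) s) = 0.
Proof.
move=> hk hs h; rewrite (ipC (H2_conv bpt hs) hk) (ip_conv_adj bpt hs hk).
rewrite (adj_prefl _ bp) (_ : (fun _ _ => _) = arr0 R) ?ip0r ?conjc0 //.
by apply: arrP => i l; apply: h.
Qed.

(* If [p g = p~ f] then [g_r := (p(z) / p(r z)) g] equals [p~ s] with
   [s := f / p(r z)] in [H2]; hence [k] is orthogonal to every [g_r], and [g_r]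
   tends weakly to [g]. *)
Lemma KTheta_of_conv k : H2 k ->
  (forall i l, conv (pcoef p) k (m + i)%N (n + l)%N = 0) -> KTheta p pt k.
Proof.
move=> hk h; split=> // g [hg [f [hf pgf]]].
have p0 := pcoef00_neq0 nzp.
have [c hc] := conv_inv p0.
(* [E r] is [g_r - g], written with the formal inverse [c] of [p]; [B] bounds its squared norm via
   [nsq_add_le] and the factor of [dilation_bound]. *)
pose B := 2 * nsq g + 2 * (2 ^+ (m + n) * nsq g).
pose E (r : R) := conv (conv (pcoef p) g) (arr_sub (dil (Complex r 0) c) c).
have main (r : R) : 2^-1 <= r < 1 ->
    [/\ H2 (E r), nsq (E r) <= B & ip k g = - ip k (E r)].
  move=> /andP[r0 r1]; have rp : 0 <= r by apply: le_trans r0; rewrite invr_ge0.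
  set rc := Complex r 0.
  have hcr : conv (pcoef (pdil rc p)) (dil rc c) = pcoef 1.
    by rewrite -dil_pcoef conv_dil hc dil_one.
  pose x := conv (dil rc c) g; pose s := conv (dil rc c) f.
  have xg : conv (pcoef (pdil rc p)) x = g by rewrite /x convA hcr conv1l.
  have sf : conv (pcoef (pdil rc p)) s = f by rewrite /s convA hcr conv1l.
  have hr : 2^-1 <= r <= 1 by rewrite r0 ltW.
  have hr' : 0 <= r < 1 by rewrite rp.
  have [hF nF] : H2 (conv (pcoef p) x) /\
      nsq (conv (pcoef p) x) <= 2 ^+ (m + n) * nsq g.
    by have := dilation_bound bp nzp (x := x) hr; rewrite -/rc xg; apply.
  have hs : H2 s by apply: (dilation_H2 bp nzp hr'); rewrite -/rc sf.
  have Fs : conv (pcoef p) x = conv (pcoef pt) s.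
    by rewrite /x /s [LHS]convCA [RHS]convCA pgf.
  have EE : E r = arr_sub (conv (pcoef p) x) g.
    rewrite /E conv_sub; congr arr_sub; first by rewrite convC /x convCA.
    by rewrite convC convA (convC c) hc conv1l.
  rewrite EE; split; first exact: H2_sub.
    rewrite arr_subE; apply: le_trans (nsq_add_le hF (H2_scale _ hg)) _.
    by rewrite nsq_scale // normsqN normsq1 /B; lra.
  by rewrite ipBr // Fs ip_conv_prefl // sub0r opprK.
(* If [V > 0], split [k] into a finite block and a tail. The squared pairing of the tail with [E r]
   is at most [V / 8] uniformly in [r], while on the block the coefficients of [E r] tend to
   zero. *)
apply: normsq_eq0; apply/eqP; rewrite eq_le normsq_ge0 andbT leNgt; apply/negP => V0.
set V := normsq _ in V0.
have B0 : 0 <= B.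
  by rewrite addr_ge0 // mulr_ge0 // ?nsq_ge0 // mulr_ge0 ?exprn_ge0 ?nsq_ge0.
have e0 : 0 < V / (8 * (B + 1)) by rewrite divr_gt0 // mulr_gt0 // ltr_wpDl.
have [N hN] := nsq_cut_small hk e0.
have [M M0 hM] : exists2 M : R, 0 <= M & forall r : R, 0 <= r <= 1 ->
    squaresum (fun j l => normsq (E r j l)) N <= M * (1 - r).
  pose Mf (j l : nat) := sval (cid2 (conv_dil_lip c (conv (pcoef p) g) j l)).
  exists (squaresum Mf N).
    by apply: squaresum_ge0 => j l; rewrite /Mf; case: cid2.
  move=> r hr; rewrite mulrC -squaresumZ; apply: squaresum_le => j l.
  by rewrite mulrC /Mf; case: cid2 => M M0 /= h'; apply: h'.
(* The dilation parameter will be [r = 1 - d]. The denominator yields [2 nsq k M d <= V / 4], and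
   also [d <= 1 / 2], so that [r >= 1 / 2] as [dilation_bound] asks. *)
pose d := V / (8 * (nsq k * M + 1 + V)).
have kM0 : 0 <= nsq k * M by rewrite mulr_ge0 ?nsq_ge0.
have d0 : 0 < d by rewrite divr_gt0 // mulr_gt0 //; lra.
have dE : d * (8 * (nsq k * M + 1 + V)) = V.
  by rewrite divfK // gt_eqF // mulr_gt0 //; lra.
have dV : 0 <= d * V by rewrite mulr_ge0 ?ltW.
have dX : 0 <= d * (nsq k * M) by rewrite mulr_ge0 // ltW.
have dk : 2 * (nsq k * (M * d)) <= V / 4 by nra.
have dh : d <= 2^-1 by rewrite -(ler_pM2r V0); nra.
have r1 : 2^-1 <= 1 - d < 1 by apply/andP; split; lra.
have r2 : 0 <= 1 - d <= 1 by apply/andP; split; lra.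
have [hE nE ipg] := main _ r1; have := hM _ r2; rewrite subKr => hMd.
have : V <= 2 * normsq (ip (cut N k) (E (1 - d)))
          + 2 * normsq (ip (arr_sub k (cut N k)) (E (1 - d))).
  have hkN := H2_cut N hk.
  rewrite /V ipg normsqN.
  have {1}-> : k = arr_add (cut N k) (arr_sub k (cut N k)).
    by apply: arrP => j l; rewrite /arr_add /arr_sub; ring.
  rewrite ipDl //; last exact: H2_sub.
  exact: normsqD.
have : normsq (ip (cut N k) (E (1 - d))) <= nsq k * (M * d).
  rewrite ip_cut; apply: le_trans (ip_CS (H2_cut N hk) (H2_cut N hE)) _.
  rewrite !nsq_cut ler_pM ?squaresum_le_nsq ?squaresum_ge0 // => *; exact: normsq_ge0.
have : normsq (ip (arr_sub k (cut N k)) (E (1 - d))) <= V / (8 * (B + 1)) * B.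
  apply: le_trans (ip_CS (H2_sub hk (H2_cut N hk)) hE) _.
  by rewrite ler_pM ?nsq_ge0 // ?ltW //; apply/H2_sub/H2_cut.
have : V / (8 * (B + 1)) * B <= V / 8.
  rewrite mulrAC ler_pdivrMr; last by rewrite mulr_gt0 // ltr_wpDl.
  by nra.
by lra.
Qed.

Lemma ThetaH2_Mz1 P Q g : ThetaH2 P Q g -> ThetaH2 P Q (Mz1 g).
Proof.
move=> [hg [f [hf e]]]; split; first exact: H2_Mz1.
by exists (Mz1 f); split; [exact: H2_Mz1 | rewrite !conv_Mz1 e].
Qed.

Lemma KTheta_B1 P Q h : KTheta P Q h -> KTheta P Q (B1 h).
Proof.
move=> [hh K]; split=> [|g hg]; first exact: H2_B1.
have [Hg _] := hg; rewrite (ipC Hg (H2_B1 hh)) -(ip_Mz1 Hg hh) -(ipC (H2_Mz1 Hg) hh).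
exact/K/ThetaH2_Mz1.
Qed.

Variables S1 S2 : set arr.
Hypothesis ort : forall s1 s2, S1 s1 -> S2 s2 -> ip s1 s2 = 0.
Hypothesis S1K : S1 `<=` KTheta p pt.
Hypothesis S2K : S2 `<=` KTheta p pt.
Hypothesis dec : forall h, KTheta p pt h ->
  exists s1 s2, [/\ S1 s1, S2 s2 & h = arr_add s1 s2].
Hypothesis S1z : forall s, S1 s -> S1 (Mz1 s).
Hypothesis S2z : forall s, S2 s -> S2 (Mz2 s).

Let S1H s : S1 s -> H2 s. Proof. by move=> /S1K[]. Qed.
Let S2H s : S2 s -> H2 s. Proof. by move=> /S2K[]. Qed.

(** Apply [KTheta_conv] to [z2^n s], which stays in [S2]: the index shift by [n] cancels the lower
    bound on the degree in [z2]. *)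
Lemma S2_conv s j k : S2 s -> conv (pcoef p) s (m + j)%N k = 0.
Proof.
move=> hs; have hsn i : S2 (iter i (@Mz2 R) s) by elim: i => //= i; apply: S2z.
have e i : conv (pcoef p) (iter i (@Mz2 R) s) = iter i (@Mz2 R) (conv (pcoef p) s).
  by elim: i => //= i IH; rewrite conv_Mz2 IH.
have := KTheta_conv j k (S2K (hsn n)); rewrite e iter_Mz2E leq_addr.
by rewrite addKn.
Qed.

Lemma S1_conv s j k : S1 s -> conv (pcoef p) s j (n + k)%N = 0.
Proof.
move=> hs; have hsn i : S1 (iter i (@Mz1 R) s) by elim: i => //= i; apply: S1z.
have e i : conv (pcoef p) (iter i (@Mz1 R) s) = iter i (@Mz1 R) (conv (pcoef p) s).
  by elim: i => //= i IH; rewrite conv_Mz1 IH.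
have := KTheta_conv j k (S1K (hsn m)); rewrite e iter_Mz1E leq_addr.
by rewrite addKn.
Qed.

(** The [S1] part [s1] of [B1 s] satisfies [ip s1 (B1 s) = ip (Mz1 s1) s = 0], as [S1] is invariant
    under [z1] and orthogonal to [S2]; hence it vanishes. *)
Lemma S2_B1 s : S2 s -> S2 (B1 s).
Proof.
move=> hs; have [s1 [s2 [h1 h2 e]]] := dec (KTheta_B1 (S2K hs)).
have H1 := S1H h1; have Hs := S2H hs; have H2' := S2H h2.
suff s10 : s1 = arr0 R.
  by rewrite e s10 (_ : arr_add _ _ = s2) //; apply: arrP => j k; rewrite /arr_add add0r.
apply: nsq_eq0 => //; rewrite /nsq.
have : ip s1 (arr_add s1 s2) = 0 by rewrite -e -(ip_Mz1 H1 Hs); apply: ort => //; apply: S1z.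
by rewrite ipDr // (ort h1 h2) addr0 => ->.
Qed.

End Spaces.

(** * Numerical radius one forces a zero on the torus *)

Lemma peval_bideg m n P z1 z2 : bideg_le m n P ->
  peval P z1 z2 = \sum_(i < m.+1) \sum_(l < n.+1) pcoef P i l * (z1 ^+ i * z2 ^+ l).
Proof.
move=> [hn hm]; rewrite /peval (horner_coef_wide _ hn) horner_sum exchange_big.
apply: eq_bigr => l _; rewrite hornerM -rmorphXn hornerC (horner_coef_wide _ (hm l)).
by rewrite mulr_suml; apply: eq_bigr => i _; rewrite mulrA.
Qed.

Lemma nsq_sum M (G : nat -> arr) : (forall i, H2 (G i)) ->
  nsq (fun j k => \sum_(i < M) G i j k) <= 2 ^+ M * \sum_(i < M) nsq (G i).
Proof.
move=> h; elim: M => [|M IH].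
  rewrite big_ord0 mulr0 (_ : (fun _ _ => _) = arr0 R); first by rewrite /nsq ip0l.
  by apply: arrP => j k; rewrite big_ord0.
rewrite (_ : (fun _ _ => _) = arr_add (fun j k => \sum_(i < M) G i j k) (G M)).
  apply: le_trans (nsq_add_le (H2_sum M h) (h M)) _.
  rewrite exprS -mulrA -mulrDr ler_pM2l // big_ord_recr /= mulrDr lerD //.
  by rewrite ler_peMl ?nsq_ge0 // exprn_ege1 // ler1n.
by apply: arrP => j k; rewrite big_ord_recr.
Qed.

Definition polyz2 q : {poly {poly C}} := map_poly polyC q.

Lemma bideg_polyz2 q : bideg_le 0 (size q) (polyz2 q).
Proof.
split; first by apply: leqW; rewrite size_map_polyC.
by move=> k; rewrite coef_map size_polyC leq_b1.
Qed.

Lemma pcoef_polyz2 q j k : pcoef (polyz2 q) j k = if j == 0%N then q`_k else 0.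
Proof. by rewrite /pcoef coef_map coefC. Qed.

Lemma conv_subl P Q x :
  conv (pcoef (P - Q)) x = arr_sub (conv (pcoef P) x) (conv (pcoef Q) x).
Proof.
rewrite !(convC (pcoef _)) -conv_sub; congr conv.
by apply: arrP => j k; rewrite /pcoef /arr_sub !coefB.
Qed.

Lemma conv_const z x : conv (pcoef (polyz2 z%:P)) x = arr_scale z x.
Proof.
have b : bideg_le 0 0 (polyz2 z%:P).
  split; first by rewrite size_map_polyC size_polyC leq_b1.
  by move=> k; rewrite coef_map size_polyC leq_b1.
by apply: arrP => j k; rewrite (conv_bideg _ _ _ b) !big_ord1 pcoef_polyz2 coefC.
Qed.

Lemma polyz2X : polyz2 'X = 'X. Proof. exact: map_polyX. Qed.

Lemma polyz2B q1 q2 : polyz2 (q1 - q2) = polyz2 q1 - polyz2 q2.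
Proof. exact: rmorphB. Qed.

Lemma polyz2M q1 q2 : polyz2 (q1 * q2) = polyz2 q1 * polyz2 q2.
Proof. exact: rmorphM. Qed.

(** The reverse triangle inequality for the isometry [z2]; squared, it reduces to
    [Re <z2 h, z h> <= |z| nsq h], which is Cauchy-Schwarz. *)
Lemma nsq_Mz2_sub z h : H2 h ->
  (1 - normc z) ^+ 2 * nsq h <= nsq (arr_sub (Mz2 h) (arr_scale z h)).
Proof.
move=> hh; have h1 := H2_Mz2 hh; have h2 := H2_scale z hh.
rewrite nsq_sub // nsq_Mz2 // nsq_scale // -(normc_sq z).
have := ip_CS h1 h2; rewrite nsq_Mz2 // nsq_scale // -(normc_sq z) /normsq.
have := nsq_ge0 hh; have := normc_ge0 z; set I := ip _ _.
move: (Re I) (Im I) (nsq h) (normc z) => u v N s s0 N0 cs.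
suff : u <= s * N by nra.
have sN : 0 <= s * N by rewrite mulr_ge0.
rewrite leNgt; apply/negP => lt; have := sqr_ge0 v.
have : 0 < (u - s * N) * (u + s * N) by rewrite mulr_gt0 //; lra.
by nra.
Qed.

(** Over the complex numbers [q] splits into linear factors, each bounded below by [nsq_Mz2_sub]
    since no root has modulus 1. *)
Lemma polyz2_lower q : q != 0 -> (forall z, normc z = 1 -> q.[z] != 0) ->
  exists2 c : R, 0 < c & forall h, H2 h -> c * nsq h <= nsq (conv (pcoef (polyz2 q)) h).
Proof.
move=> q0 hq; have [rs Dq] := closed_field_poly_normal q.
have hrs z : z \in rs -> normc z != 1.
  move=> hz; apply: contraTneq isT => /hq; rewrite Dq -rootE rootZ ?lead_coef_eq0 //.
  by rewrite root_prod_XsubC hz.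
have [c c0 hc] : exists2 c : R, 0 < c & forall h, H2 h ->
    c * nsq h <= nsq (conv (pcoef (polyz2 (\prod_(z <- rs) ('X - z%:P)))) h).
  elim: rs hrs {Dq} => [|z rs IH] hrs.
    exists 1 => // h hh; rewrite big_nil /polyz2 rmorph1 conv1l mul1r //.
  have [|c c0 hc] := IH; first by move=> w hw; apply: hrs; rewrite inE hw orbT.
  exists ((1 - normc z) ^+ 2 * c) => [|h hh].
    rewrite mulr_gt0 // lt_neqAle sqr_ge0 andbT eq_sym sqrf_eq0 subr_eq0 eq_sym.
    by apply: hrs; rewrite mem_head.
  set T := \prod_(j <- rs) _ in hc; pose y := conv (pcoef (polyz2 T)) h.
  have hy : H2 y := H2_conv (bideg_polyz2 T) hh.
  have -> : conv (pcoef (polyz2 (\prod_(j <- z :: rs) ('X - j%:P)))) h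
      = arr_sub (Mz2 y) (arr_scale z y).
    rewrite big_cons -/T polyz2M -conv_poly -/y polyz2B polyz2X.
    by rewrite conv_subl conv_const Mz2_conv.
  apply: le_trans (nsq_Mz2_sub z hy); rewrite -mulrA ler_wpM2l ?sqr_ge0 //.
  exact: hc.
exists (normsq (lead_coef q) * c) => [|h hh].
  rewrite mulr_gt0 // lt_neqAle normsq_ge0 andbT eq_sym; apply/eqP => /normsq_eq0/eqP.
  by rewrite lead_coef_eq0 (negbTE q0).
set T := \prod_(z <- rs) _ in Dq hc.
have -> : conv (pcoef (polyz2 q)) h
    = arr_scale (lead_coef q) (conv (pcoef (polyz2 T)) h).
  by rewrite [in LHS]Dq -mul_polyC polyz2M -conv_poly conv_const.
rewrite nsq_scale; last exact: H2_conv (bideg_polyz2 T) hh.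
by rewrite -mulrA ler_wpM2l ?normsq_ge0 // hc.
Qed.

Lemma sqr_le_norm (s e : R) : 0 <= e -> s ^+ 2 <= e ^+ 2 -> `|s| <= e.
Proof.
by move=> e0; rewrite -[s ^+ 2]real_normK ?num_real // ler_pXn2r ?nnegrE.
Qed.

Lemma bounded_seq_cluster (l : nat -> C) : (forall k, normsq (l k) <= 1) ->
  exists z, forall (e : R) (K : nat), 0 < e -> exists2 k, (K <= k)%N & normsq (l k - z) <= e.
Proof.
move=> hl; pose I : set R := `[-1, 1]%classic.
have cI : compact (I `*` I) by apply: compact_setX; exact: segment_compact.
pose F := (fun k => (Re (l k), Im (l k))) @ \oo.
have FI : F (I `*` I).
  exists 0%N => // k _ /=; have := hl k; rewrite /normsq => h.
  have := sqr_ge0 (Re (l k)); have := sqr_ge0 (Im (l k)) => i0 r0.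
  by split; rewrite /I /= in_itv /=; apply/andP; split; nra.
have [[u v] [_ cl]] := cI F _ FI.
exists (Complex u v) => e K e0; pose d := Num.min 1 (e / 2).
have d0 : 0 < d by rewrite lt_min ltr01 divr_gt0.
have FK : F [set x | exists2 k, (K <= k)%N & x = (Re (l k), Im (l k))].
  by exists K => // k /= hk; exists k.
have [x [[k hk ->] /= [b1 b2]]] := cl _ _ FK (nbhsx_ballx (u, v) d d0).
exists k => //; move: b1 b2; rewrite /ball /= => b1 b2.
rewrite /normsq ReD ImD; case: (l k) b1 b2 => s t /= b1 b2.
have dd : d * d <= e / 2.
  have d1 : d <= 1 by rewrite ge_min lexx.
  have d2 : d <= e / 2 by rewrite ge_min lexx orbT.
  by nra.
have sq (s' t' : R) : `|s' - t'| < d -> (t' - s') ^+ 2 <= d * d.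
  by rewrite ltr_norml => /andP[? ?]; nra.
by have := sq _ _ b1; have := sq _ _ b2; lra.
Qed.

Section RadiusOne.
Variables (m n : nat) (p : {poly {poly C}}) (S : set arr).
Hypothesis bp : bideg_le m n p.
Hypothesis SH : S `<=` @H2 R.
Hypothesis Sconv : forall s j k, S s -> conv (pcoef p) s (m + j)%N k = 0.

(** Take [l = ip (B1 h) h] for a unit vector [h] with nearly extremal value: the squared norm of
    [B1 h - l h] is [nsq (B1 h) - normsq l <= 1 - normsq l]. *)
Lemma numradius_approx (e : R) : numradius_compr_z1 S = 1 -> 0 < e ->
  exists h l, [/\ S h, nsq h = 1, nsq (arr_sub (B1 h) (arr_scale l h)) <= e,
    1 - e <= normsq l & normsq l <= 1].
Proof.
rewrite /numradius_compr_z1; set E := (X in sup X) => E1 e0.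
(* [sup] takes the default value 0 on a set without supremum, which the value 1 excludes. *)
have hE : has_sup E.
  apply: contrapT => /sup_out E0; move: E1; rewrite E0 => /eqP.
  by rewrite eq_sym oner_eq0.
pose d := Num.min 1 (e / 2).
have d0 : 0 < d by rewrite lt_min ltr01 divr_gt0.
have d1 : d <= 1 by rewrite ge_min lexx.
have d2 : d <= e / 2 by rewrite ge_min lexx orbT.
have [_ [_ [h [y [Sh h1 [Sy py] ->]] <-]]] := sup_adherent d0 hE.
rewrite E1 => lt; have hh := SH Sh; have hy := SH Sy.
have ipy : ip y h = ip (Mz1 h) h.
  apply/esym/eqP; rewrite -subr_eq0; apply/eqP; rewrite -ipBl //; last exact: H2_Mz1.
  exact: py.
exists h, (conjc (ip y h)).
have n1 : normsq (ip y h) <= 1.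
  by rewrite ipy; apply: le_trans (ip_CS (H2_Mz1 hh) hh) _; rewrite nsq_Mz1 // h1 mulr1.
have n2 : 1 - e <= normsq (ip y h).
  by rewrite -normc_sq; have := normc_ge0 (ip y h); nra.
split; rewrite ?normsqJ //.
have hB := H2_B1 hh.
rewrite nsq_sub ?nsq_scale ?ipZr ?normsqJ ?conjcK //; last exact: H2_scale.
have -> : ip (B1 h) h = conjc (ip y h).
  by rewrite ipy (ip_Mz1 hh hh) -(ipC hh hB).
rewrite mulcJ /= h1 mulr1; have := nsq_B1 hh; rewrite h1; lra.
Qed.

(** A cluster point of the approximate eigenvalues for tolerances tending to zero serves every
    tolerance at once. *)
Lemma numradius_eigen : numradius_compr_z1 S = 1 ->
  exists2 l, normsq l = 1 & forall e : R, 0 < e ->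
    exists h, [/\ S h, nsq h = 1 & nsq (arr_sub (B1 h) (arr_scale l h)) <= e].
Proof.
move=> E1; pose ek k : R := (k.+1%:R)^-1.
have ek0 k : 0 < ek k by rewrite invr_gt0.
have ekle k K : (K <= k)%N -> ek k <= ek K by move=> h; rewrite lef_pV2 ?posrE // ler_nat.
have arch (e : R) : 0 < e -> exists K, ek K <= e.
  by move=> e0; have [K] := ltr_add_invr e0; rewrite add0r => /ltW; exists K.
have /choice [l hl] : forall k, exists l, normsq l <= 1 /\ 1 - ek k <= normsq l /\
    exists h, [/\ S h, nsq h = 1 & nsq (arr_sub (B1 h) (arr_scale l h)) <= ek k].
  move=> k; have [h [l [a1 a2 a3 a4 a5]]] := numradius_approx E1 (ek0 k).
  by exists l; split=> //; split=> //; exists h.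
have [z hz] := bounded_seq_cluster (fun k => proj1 (hl k)).
exists z.
  have sm (e : R) : 0 < e -> e <= 1 -> `|normsq z - 1| <= 8 * e.
    move=> e0 e1; have [K hK] := arch e e0.
    have ee0 : 0 < e ^+ 2 by rewrite exprn_gt0.
    have [k hk dk] := hz (e ^+ 2) K ee0; have [n1 [n2 _]] := hl k.
    have le := le_trans (ekle _ _ hk) hK; move: dk n1 n2.
    case: (l k) (z) => [s t] [u v]; rewrite /normsq /= => dk n1 n2.
    have [s2 t2] := (sqr_ge0 s, sqr_ge0 t).
    have [su2 tv2] := (sqr_ge0 (s - u), sqr_ge0 (t - v)).
    have s1 : `|s| <= 1 by apply: sqr_le_norm => //; lra.
    have t1 : `|t| <= 1 by apply: sqr_le_norm => //; lra.
    have su : `|s - u| <= e by apply: sqr_le_norm; lra.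
    have tv : `|t - v| <= e by apply: sqr_le_norm; lra.
    move: s1 t1 su tv; rewrite !ler_norml => /andP[? ?] /andP[? ?] /andP[? ?] /andP[? ?].
    by apply/andP; split; nra.
  apply/eqP; rewrite -subr_eq0 -normr_le0 leNgt; apply/negP => V0.
  set V := `|_| in V0; pose e := Num.min 1 (V / 16).
  have e0 : 0 < e by rewrite lt_min ltr01 divr_gt0.
  have e1 : e <= 1 by rewrite ge_min lexx.
  have e2 : e <= V / 16 by rewrite ge_min lexx orbT.
  by have := sm e e0 e1; rewrite -/V; lra.
move=> e e0; have e4 : 0 < e / 4 by rewrite divr_gt0.
have [K hK] := arch _ e4; have [k hk dk] := hz _ K e4.
have [_ [_ [h [Sh h1 hB]]]] := hl k; exists h; split=> //.
have hh := SH Sh; have hBh := H2_B1 hh.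
have -> : arr_sub (B1 h) (arr_scale z h)
    = arr_add (arr_sub (B1 h) (arr_scale (l k) h)) (arr_scale (l k - z) h).
  by apply: arrP => i j; rewrite /arr_sub /arr_add /arr_scale; ring.
apply: le_trans (nsq_add_le (H2_sub hBh (H2_scale _ hh)) (H2_scale _ hh)) _.
rewrite nsq_scale // h1 mulr1; have := le_trans hB (le_trans (ekle _ _ hk) hK); lra.
Qed.

(** Write [B1^(s+1) - l^(s+1)] as [B1 (B1^s - l^s) + l^s (B1 - l)]. As [B1] is a contraction and
    [|l| = 1], the new bound is [2 4^s e + 2 e <= 4^(s+1) e]. *)
Lemma nsq_iterB1 l h (e : R) s : normsq l = 1 -> H2 h -> 0 <= e ->
  nsq (arr_sub (B1 h) (arr_scale l h)) <= e ->
  nsq (arr_sub (fun j k => h (j + s)%N k) (arr_scale (l ^+ s) h)) <= 4 ^+ s * e.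
Proof.
move=> l1 hh e0 he; elim: s => [|s IH].
  rewrite expr0 (_ : arr_sub _ _ = arr0 R); first by rewrite /nsq ip0l expr0 mul1r.
  by apply: arrP => j k; rewrite /arr_sub /arr_scale addn0 mul1r subrr.
have hB := H2_B1 hh.
pose D := arr_sub (fun j k => h (j + s)%N k) (arr_scale (l ^+ s) h).
have hD : H2 D.
  apply: H2_sub; last exact: H2_scale.
  by have := H2_iterB s 0 hh; congr H2; apply: arrP => j k; rewrite addn0.
have -> : arr_sub (fun j k => h (j + s.+1)%N k) (arr_scale (l ^+ s.+1) h)
   = arr_add (B1 D) (arr_scale (l ^+ s) (arr_sub (B1 h) (arr_scale l h))).
  apply: arrP => j k; rewrite /D /arr_sub /arr_add /arr_scale /B1 addSnnS exprS.
  by ring.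
have h1 : H2 (arr_sub (B1 h) (arr_scale l h)) by apply: H2_sub => //; apply: H2_scale.
apply: le_trans (nsq_add_le (H2_B1 hD) (H2_scale _ h1)) _.
rewrite nsq_scale // normsqX l1 expr1n mul1r.
have h4 : 1 <= 4 ^+ s :> R by rewrite exprn_ege1 // ler1n.
have e4 : e <= 4 ^+ s * e by rewrite ler_peMl.
have := nsq_B1 hD; rewrite exprS -mulrA; move: IH; rewrite -/D => IH; lra.
Qed.

(* On [S] multiplication by [p] is annihilated by [B1 ^ m]; replacing [B1] by its
   approximate eigenvalue [l] turns this into smallness of [lpoly] applied to [h]. *)
Definition lpoly (l : C) : {poly C} :=
  \poly_(k < n.+1) \sum_(i < m.+1) pcoef p i k * l ^+ (m - i).

Lemma nsq_lpoly l : normsq l = 1 -> exists2 K : R, 0 <= K &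
  forall h (e : R), S h -> 0 <= e -> nsq (arr_sub (B1 h) (arr_scale l h)) <= e ->
    nsq (conv (pcoef (polyz2 (lpoly l))) h) <= K * e.
Proof.
move=> l1; pose K := 2 ^+ m.+1 * \sum_(i < m.+1) (2 ^+ n.+1 *
  \sum_(k < n.+1) (normsq (pcoef p i k) * 4 ^+ (m - i))).
exists K.
  rewrite mulr_ge0 ?exprn_ge0 // sumr_ge0 // => i _; rewrite mulr_ge0 ?exprn_ge0 //.
  by rewrite sumr_ge0 // => k _; rewrite mulr_ge0 ?normsq_ge0 ?exprn_ge0.
move=> h e Sh e0 he; have hh := SH Sh.
pose D s := arr_sub (fun j k => h (j + s)%N k) (arr_scale (l ^+ s) h).
have hD s : H2 (D s).
  apply: H2_sub; last exact: H2_scale.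
  by have := H2_iterB s 0 hh; congr H2; apply: arrP => j k; rewrite addn0.
(* Subtracting the vanishing [B1^m (p h)] from the product of [lpoly l] and [h] leaves the sum of
   the [G i k], each of which contains [B1^(m-i) h - l^(m-i) h]. *)
pose G i k := arr_scale (- pcoef p i k) (iter k (@Mz2 R) (D (m - i)%N)).
have hG i k : H2 (G i k) by apply: H2_scale; apply: (H2_iterMz 0 k).
have nG i k : nsq (G i k) <= normsq (pcoef p i k) * 4 ^+ (m - i) * e.
  rewrite nsq_scale; last exact: (H2_iterMz 0 k (hD _)).
  rewrite normsqN -mulrA ler_wpM2l ?normsq_ge0 //.
  have -> : nsq (iter k (@Mz2 R) (D (m - i)%N)) = nsq (D (m - i)%N).
    elim: k => //= k IH; rewrite nsq_Mz2 //; exact: (H2_iterMz 0 k (hD _)).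
  exact: nsq_iterB1.
have -> : conv (pcoef (polyz2 (lpoly l))) h
    = (fun r0 s0 => \sum_(i < m.+1) (fun r0 s0 => \sum_(k < n.+1) G i k r0 s0) r0 s0).
  apply: arrP => r0 s0.
  have bl : bideg_le 0 n (polyz2 (lpoly l)).
    split; first by rewrite size_map_polyC; apply: size_poly.
    by move=> k; rewrite coef_map size_polyC leq_b1.
  rewrite (conv_bideg _ _ _ bl) big_ord1.
  apply/eqP; rewrite -subr_eq0; apply/eqP; rewrite -[RHS](Sconv r0 s0 Sh).
  rewrite (conv_bideg _ _ _ bp) [X in _ - X]exchange_big -sumrB [RHS]exchange_big.
  apply: eq_bigr => -[k hk] _; rewrite pcoef_polyz2 /= coef_poly hk mulr_suml -sumrB.
  apply: eq_bigr => -[i hi] _ /=; rewrite /G /D /arr_scale iter_Mz1E iter_Mz2E.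
  rewrite (leq_trans (_ : (i <= m)%N)) ?leq_addr // !iter_Mz2E.
  case: ifP => _; last by rewrite !mulr0 subrr.
  rewrite (_ : (m + r0 - i)%N = (r0 + (m - i))%N); last by lia.
  by rewrite /arr_sub; ring.
apply: le_trans (nsq_sum m.+1 (fun i => H2_sum n.+1 (hG i))) _.
rewrite /K -mulrA ler_wpM2l ?exprn_ge0 // mulr_suml; apply: ler_sum => i _.
apply: le_trans (nsq_sum n.+1 (hG i)) _.
rewrite -mulrA ler_wpM2l ?exprn_ge0 // mulr_suml; apply: ler_sum => k _.
exact: nG.
Qed.

(** [conjc l] is the inverse of [l], so [l ^+ (m - i) = l ^+ m * conjc l ^+ i]. *)
Lemma lpoly_eval l z : normsq l = 1 -> (lpoly l).[z] = l ^+ m * peval p (conjc l) z.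
Proof.
move=> l1; rewrite (peval_bideg _ _ bp) (horner_coef_wide _ (size_poly _ _)).
have l0 : l != 0.
  by apply/eqP => e; move: l1; rewrite e normsq0 => /eqP; rewrite eq_sym oner_eq0.
rewrite exchange_big mulr_sumr; apply: eq_bigr => -[k hk] _.
rewrite coef_poly hk mulr_suml mulr_sumr; apply: eq_bigr => -[i hi] _ /=.
rewrite (unity_conj l1) exprVn -[in RHS](subnK (_ : (i <= m)%N)) // exprD.
have li : l ^+ i != 0 by rewrite expf_neq0.
by field.
Qed.

Lemma numradius1_zero : numradius_compr_z1 S = 1 ->
  exists z1 z2, [/\ normc z1 = 1, normc z2 = 1 & peval p z1 z2 = 0].
Proof.
move=> /numradius_eigen [l l1 hl]; apply: contrapT => nz.
have nl : normc (conjc l) = 1.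
  by rewrite normcJ; apply/eqP; rewrite -(@eqrXn2 _ 2) ?normc_ge0 // normc_sq l1 expr1n.
have nzl z : normc z = 1 -> (lpoly l).[z] != 0.
  move=> z1; apply/eqP => lz; apply: nz; exists (conjc l), z; split=> //.
  move: lz; rewrite lpoly_eval // => /eqP; rewrite mulf_eq0 => /orP[|/eqP //].
  move=> /eqP lm; have : normsq (l ^+ m) = 1 by rewrite normsqX l1 expr1n.
  by rewrite lm normsq0 => /eqP; rewrite eq_sym oner_eq0.
have l0 : lpoly l != 0.
  have := nzl 1 (ComplexField.Normc.normc1 R); apply: contraNneq => ->.
  by rewrite horner0.
have [c c0 hc] := polyz2_lower l0 nzl; have [K K0 hK] := nsq_lpoly l1.
(* With this tolerance the upper bound [K c / (2 (K + 1))] is below the lower bound [c]. *)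
have e0 : 0 < c / (2 * (K + 1)) by rewrite divr_gt0 // mulr_gt0 // ltr_wpDl.
have [h [Sh h1 he]] := hl _ e0.
have := le_trans (hc h (SH Sh)) (hK h _ Sh (ltW e0) he).
rewrite h1 mulr1 mulrA ler_pdivlMr; last by rewrite mulr_gt0 // ltr_wpDl.
by nra.
Qed.

End RadiusOne.

(** * Zeros of [p] near the torus that are not zeros of [p~] *)

(** Restriction to the line [z1 = z], a polynomial in [z2]. *)
Definition ev1 z P : {poly C} := map_poly (horner_eval z) P.

Lemma peval_ev1 P z1 z2 : peval P z1 z2 = (ev1 z1 P).[z2].
Proof.
rewrite /peval /ev1 -[z2 in RHS](hornerC z2 z1).
by rewrite -[(z2%:P).[z1]]/(horner_eval z1 z2%:P) horner_map.
Qed.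

Lemma ev1M z P Q : ev1 z (P * Q) = ev1 z P * ev1 z Q.
Proof. exact: rmorphM. Qed.

Lemma ev1_eq0 z P : ev1 z P = 0 -> exists Q, P = ('X - z%:P)%:P * Q.
Proof.
move=> h; exists (\poly_(k < size P) (P`_k %/ ('X - z%:P))).
apply/polyP => k; rewrite coefCM coef_poly; case: ltnP => hk; last first.
  by rewrite mulr0 nth_default.
rewrite mulrC divpK // dvdp_XsubCl rootE -[(P`_k).[z]]/(horner_eval z P`_k).
by rewrite -coef_map -/(ev1 z P) h coef0.
Qed.

Lemma XsubC_polyC_neq0 z : ('X - z%:P)%:P != 0 :> {poly {poly C}}.
Proof. by rewrite polyC_eq0 polyXsubC_eq0. Qed.

(** While [P] vanishes on some line [z1 = z], divide by [z1 - z]; each division lowers the degree in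
    [z1] of the leading coefficient. *)
Lemma primitive_part P : P != 0 -> exists (c : {poly C}) Q,
  [/\ c != 0, P = c%:P * Q & forall z, ev1 z Q != 0].
Proof.
have [N] := ubnP (size (lead_coef P)); elim: N P => // N IH P hN P0.
have [[z /eqP hz]|hz] := pselect (exists z, ev1 z P == 0); last first.
  exists 1, P; split; rewrite ?oner_eq0 ?mul1r // => z.
  by apply/negP => h; apply: hz; exists z.
have [Q hQ] := ev1_eq0 hz.
have Q0 : Q != 0 by apply: contraNneq P0 => Q0; rewrite hQ Q0 mulr0.
have lQ : (size (lead_coef Q) < N)%N.
  rewrite -ltnS; apply: leq_trans hN; rewrite hQ lead_coefM lead_coefC.
  by rewrite size_monicM ?monicXsubC ?lead_coef_eq0 // size_XsubC.
have [c [Q' [c0 QQ hQ']]] := IH Q lQ Q0; exists (('X - z%:P) * c), Q'; split=> //.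
  by rewrite mulf_neq0 // polyXsubC_eq0.
by rewrite hQ {1}QQ polyCM mulrA.
Qed.

(* Gauss's lemma: linear factors of [c] divide [Q] since [D] is primitive. *)
Lemma gauss_dvd (c : {poly C}) (P Q D : {poly {poly C}}) : c != 0 ->
  (forall z, ev1 z D != 0) -> c%:P * P = D * Q -> pdivides D P.
Proof.
move=> + hD; have [N] := ubnP (size c); elim: N c Q => // N IH c Q hN c0 e.
have [hc|hc] := leqP (size c) 1.
  have ck := size1_polyC hc; have k0 : c`_0 != 0 by rewrite -polyC_eq0 -ck.
  exists (((c`_0)^-1)%:P%:P * Q); rewrite mulrCA -e mulrA {2}ck -!polyCM mulVf //.
  by rewrite !polyC1 mul1r.
have [z /factor_theorem [c' hc']] : exists z, root c z.
  by apply/closed_rootP; rewrite neq_ltn hc orbT.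
have c'0 : c' != 0 by apply: contraNneq c0 => c'0; rewrite hc' c'0 mul0r.
have : ev1 z D * ev1 z Q = 0.
  rewrite -ev1M -e ev1M /ev1 map_polyC /= /horner_eval hc' !hornerE subrr mulr0.
  by rewrite mul0r.
move=> /eqP; rewrite mulf_eq0 (negbTE (hD z)) => /eqP /ev1_eq0 [Q' hQ'].
apply: (IH c' Q') => //.
  rewrite -ltnS; apply: leq_trans hN; rewrite hc' size_Mmonic ?monicXsubC //.
  by rewrite size_XsubC addn2.
apply: (mulfI (XsubC_polyC_neq0 z)); rewrite mulrA -polyCM [_ * c']mulrC -hc' e.
by rewrite hQ' mulrCA.
Qed.

(** Elimination of [z2]: were the gcd in [z2] nonconstant, its primitive part would divide both
    polynomials by [gauss_dvd]. The first coordinate of every common zero is then a root of [c]. *)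
Lemma pcoprime_bezout P Q : P != 0 -> pcoprime P Q ->
  exists2 c : {poly C}, c != 0 & exists U V, c%:P = U * P + V * Q.
Proof.
move=> P0 cop; have [|ncop] := boolP (coprimep P Q).
  move=> /Bezout_coprimepP [[U V] /= /eqpP [[c1 c2] /= /andP[c10 c20] e]].
  exists c2 => //; exists (c1%:P * U), (c1%:P * V).
  by rewrite -!mulrA -mulrDr mul_polyC e alg_polyC.
have d0 : gcdp P Q != 0 by rewrite gcdp_eq0 negb_and P0.
have [c [D [c0 dD hD]]] := primitive_part d0.
have szD : size D = size (gcdp P Q).
  by rewrite dD mul_polyC size_scale.
have dv T : gcdp P Q %| T -> pdivides D T.
  move=> /Pdiv.Idomain.dvdpP [[k q] /= k0 e].
  by apply: (gauss_dvd (c := k) (Q := q * c%:P)) => //; rewrite mul_polyC e dD; ring.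
have [k Dk] := cop D (dv P (dvdp_gcdl _ _)) (dv Q (dvdp_gcdr _ _)).
move: ncop; rewrite coprimep_def -szD Dk size_polyC.
have D0 : D != 0 by apply: contraNneq d0 => D0; rewrite dD D0 mulr0.
by move: D0; rewrite Dk polyC_eq0 => ->.
Qed.

(** The reflection [1 / conj z] fixes the circle, so if [P] vanishes on the line [z1 = z], so does
    [prefl m n P], and [z1 - z] is a common factor. *)
Lemma pcoprime_ev1 m n P z : bideg_le m n P -> normc z = 1 ->
  pcoprime P (prefl m n P) -> ev1 z P != 0.
Proof.
move=> bP z1 cop; apply/eqP => e0; have nz : normsq z = 1 by rewrite -normc_sq z1 expr1n.
have z0 : z != 0 by rewrite -normc_eq0 z1 oner_eq0.
have e1 : ev1 z (prefl m n P) = 0.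
  apply/polyP => k; rewrite coef0 coef_map /= /horner_eval /prefl coef_poly.
  case: ltnP => hk; last by rewrite horner0.
  rewrite horner_poly; transitivity (z ^+ m * conjc (P`_(n - k)).[z]).
    rewrite (horner_coef_wide _ (proj2 bP _)) rmorph_sum mulr_sumr.
    rewrite (reindex_inj rev_ord_inj); apply: eq_bigr => -[i hi] _ /=.
    rewrite subSS subKn // rmorphM rmorphXn /= (unity_conj nz) mulrCA; congr (_ * _).
    by rewrite exprVn -expfB_cond // (negbTE z0).
  have -> : (P`_(n - k)).[z] = (ev1 z P)`_(n - k) by rewrite coef_map.
  by rewrite e0 coef0 conjc0 mulr0.
have [Q1 h1] := ev1_eq0 e0; have [Q2 h2] := ev1_eq0 e1.
have [||c hc] := cop ('X - z%:P)%:P; [by exists Q1|by exists Q2|].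
have := congr1 (fun T : {poly {poly C}} => size (T`_0)) hc.
by rewrite !coefC /= size_XsubC size_polyC; case: (c == 0).
Qed.

Lemma pcoprime_ev2 m n P z : bideg_le m n P -> normc z = 1 ->
  pcoprime P (prefl m n P) -> P.[z%:P] != 0.
Proof.
move=> bP z1 cop; apply/eqP => e0; have nz : normsq z = 1 by rewrite -normc_sq z1 expr1n.
have z0 : z != 0 by rewrite -normc_eq0 z1 oner_eq0.
have coefz Q : bideg_le m n Q -> forall j,
    (Q.[z%:P])`_j = \sum_(k < n.+1) pcoef Q j k * z ^+ k.
  move=> bQ j; rewrite (horner_coef_wide _ (proj1 bQ)) coef_sum.
  by apply: eq_bigr => k _; rewrite -rmorphXn coefMC.
have e1 : (prefl m n P).[z%:P] = 0.
  apply/polyP => j; rewrite coef0 coefz; last exact: bideg_prefl.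
  have [hj|hj] := leqP j m; last first.
    by apply: big1 => k _; rewrite pcoef_prefl leqNgt hj mul0r.
  transitivity (z ^+ n * conjc (P.[z%:P])`_(m - j)); last by rewrite e0 coef0 conjc0 mulr0.
  rewrite coefz // rmorph_sum mulr_sumr (reindex_inj rev_ord_inj).
  apply: eq_bigr => -[k hk] _ /=; rewrite subSS pcoef_prefl hj leq_subr subKn //=.
  rewrite rmorphM rmorphXn /= (unity_conj nz) mulrCA; congr (_ * _).
  by rewrite exprVn -expfB_cond // (negbTE z0).
have /factor_theorem [Q1 h1] : root P z%:P by rewrite rootE e0.
have /factor_theorem [Q2 h2] : root (prefl m n P) z%:P by rewrite rootE e1.
have [||c hc] := cop ('X - z%:P%:P).
- by exists Q1; rewrite h1 mulrC.
- by exists Q2; rewrite h2 mulrC.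
have := congr1 (fun T : {poly {poly C}} => size T) hc.
by rewrite size_XsubC size_polyC; case: (_ == 0).
Qed.

Lemma isolated_root q z : q != 0 -> exists2 d : R, 0 < d &
  forall w, root q w -> normc (w - z) <= d -> w = z.
Proof.
move=> q0; have [rs Dq] := closed_field_poly_normal q.
have [d d0 hd] : exists2 d : R, 0 < d &
    forall w, w \in rs -> normc (w - z) <= d -> w = z.
  elim: rs {Dq} => [|w rs [d d0 IH]]; first by exists 1.
  have [->|ne] := eqVneq w z.
    by exists d => // w'; rewrite inE => /orP[/eqP -> //|]; apply: IH.
  have w0 : 0 < normc (w - z).
    by rewrite lt_neqAle normc_ge0 andbT eq_sym normc_eq0 subr_eq0.
  exists (Num.min d (normc (w - z) / 2)); first by rewrite lt_min d0 divr_gt0.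
  move=> w'; rewrite inE le_min => /orP[/eqP ->|hw'] /andP[h1 h2]; last exact: IH.
  by exfalso; lra.
exists d => // w; rewrite Dq rootZ ?lead_coef_eq0 // root_prod_XsubC; exact: hd.
Qed.

Lemma normc_horner_le q z (A : R) : normc z <= A ->
  normc q.[z] <= \sum_(i < size q) normc q`_i * A ^+ i.
Proof.
move=> hA; rewrite horner_coef.
apply: (@le_trans _ _ (\sum_(i < size q) normc (q`_i * z ^+ i))).
  elim/big_ind2: _ => [|x1 x2 y1 y2 h1 h2|//]; first by rewrite ComplexField.Normc.normc0.
  exact: le_trans (le_normcD _ _) (lerD h1 h2).
apply: ler_sum => i _; rewrite ComplexField.Normc.normcM normcX ler_wpM2l ?normc_ge0 //.
by rewrite lerXn2r ?nnegrE ?normc_ge0 // (le_trans (normc_ge0 z)).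
Qed.

Lemma poly_continuous q z (e : R) : 0 < e -> exists2 d : R, 0 < d &
  forall w, normc (w - z) <= d -> normc (q.[w] - q.[z]) <= e.
Proof.
move=> e0; have /factor_theorem [g hg] : root (q - q.[z]%:P) z by rewrite rootE !hornerE subrr.
pose A := normc z + 1; pose M := \sum_(i < size g) normc g`_i * A ^+ i.
have M0 : 0 <= M.
  by apply: sumr_ge0 => i _; rewrite mulr_ge0 ?exprn_ge0 ?addr_ge0 ?normc_ge0.
exists (Num.min 1 (e / (M + 1))) => [|w].
  by rewrite lt_min ltr01 divr_gt0 // ltr_wpDl.
rewrite le_min => /andP[w1 w2].
have -> : q.[w] - q.[z] = g.[w] * (w - z).
  by have := congr1 (fun T : {poly C} => T.[w]) hg; rewrite !hornerE.
have hw : normc w <= A.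
  rewrite -(subrK z w) /A addrC; apply: le_trans (le_normcD _ _) _.
  by rewrite lerD2l.
rewrite ComplexField.Normc.normcM; apply: (@le_trans _ _ (M * (e / (M + 1)))).
  by rewrite ler_pM ?normc_ge0 // normc_horner_le.
rewrite mulrCA -[leRHS]mulr1 ler_wpM2l ?(ltW e0) //.
by rewrite ler_pdivrMr ?ltr_wpDl // mul1r lerDl.
Qed.

Lemma coef_lin_prod_le (S : seq C) (A : R) d : 0 <= A ->
  (forall s, s \in S -> normc s <= A) ->
  normc (\prod_(s <- S) (1%:P + (- s) *: 'X) : {poly C})`_d <= (1 + A) ^+ size S.
Proof.
move=> A0; elim: S d => [|s S IH] d hS.
  rewrite big_nil coef1 expr0; case: (d == _); rewrite ?ComplexField.Normc.normc1 //.
  by rewrite ComplexField.Normc.normc0.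
have hS' s' : s' \in S -> normc s' <= A by move=> hs'; apply: hS; rewrite inE hs' orbT.
have IH' e := IH e hS'.
rewrite big_cons coef_lin_mul mul1r; apply: le_trans (le_normcD _ _) _.
rewrite exprS mulrDl mul1r lerD // ComplexField.Normc.normcM ler_pM ?normc_ge0 //.
  by rewrite normcN; apply: hS; rewrite mem_head.
by case: d => [|d] //; rewrite ComplexField.Normc.normc0 exprn_ge0 // addr_ge0.
Qed.

(** If every root had modulus at least [e], the reciprocals in [poly_factor] would be at most
    [e^-1], and [coef_lin_prod_le] would bound every coefficient by [|q(0)| (1 + e^-1)^m]. *)
Lemma small_root q m (e : R) d : (size q <= m.+1)%N -> q.[0] != 0 -> 0 < e ->
  normc q.[0] * (1 + e^-1) ^+ m < normc q`_d ->
  exists2 z, root q z & normc z < e.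
Proof.
move=> sq q0 e0 lt; apply: contrapT => nr.
have [S [sS qS rS]] := poly_factor sq q0.
move: lt; apply/negP; rewrite -leNgt {1}qS coefZ ComplexField.Normc.normcM.
rewrite ler_wpM2l ?normc_ge0 // -sS; apply: coef_lin_prod_le.
  by rewrite invr_ge0 ltW.
move=> s /rS [->|rs]; first by rewrite ComplexField.Normc.normc0 invr_ge0 ltW.
rewrite leNgt; apply/negP => hs; apply: nr; exists s^-1 => //.
have s0 : 0 < normc s by apply: lt_trans hs; rewrite invr_gt0.
by rewrite ComplexField.Normc.normcV -(invrK e) ltf_pV2 ?posrE ?invr_gt0.
Qed.

(** Move [t2] radially to [w] inside the disk. Expanded at [t1], the polynomial [P(. , w)] has a
    small constant term and another coefficient bounded away from 0, so [small_root] gives a root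
    near [t1]. If it were also a zero of [prefl m n P], its first coordinate would be a root of [c]
    near [t1], hence [t1] itself, but [P(t1, w)] is nonzero. *)
Lemma zero_near_torus m n P (t1 t2 : C) (e : R) : bideg_le m n P ->
  pcoprime P (prefl m n P) -> normc t1 = 1 -> normc t2 = 1 -> peval P t1 t2 = 0 ->
  0 < e -> exists z w, [/\ normc w < 1, peval P z w = 0, peval (prefl m n P) z w != 0 &
    normc (z - t1) < e].
Proof.
move=> bP cop n1 n2 P0 e0.
have E1 := pcoprime_ev1 bP n1 cop; have E2 := pcoprime_ev2 bP n2 cop.
have P_0 : P != 0 by apply: contraNneq E2 => ->; rewrite horner0.
have [c c0 [U [V cUV]]] := pcoprime_bezout P_0 cop.
have [d1 d10 hd1] := isolated_root t1 c0.
have [d2 d20 hd2] := isolated_root t2 E1.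
pose e' := Num.min e d1; have e'0 : 0 < e' by rewrite lt_min e0.
(* [G w] is [P(. , w)] expanded at [t1], and [g d] is its [d]-th coefficient as a polynomial, hence
   continuous, in [w]. *)
pose G w := P.[w%:P] \Po ('X + t1%:P).
pose g d : {poly C} := \sum_(k < size P) ((P`_k \Po ('X + t1%:P))`_d) *: 'X^k.
have gE w d : (G w)`_d = (g d).[w].
  rewrite /G horner_coef linear_sum coef_sum /g horner_sum; apply: eq_bigr => k _ /=.
  by rewrite -rmorphXn mulrC mul_polyC comp_polyZ coefZ hornerZ hornerXn mulrC.
have Gev w z : (G w).[z] = peval P (z + t1) w by rewrite /G horner_comp !hornerE.
have G2 : G t2 != 0 by rewrite /G comp_poly_eq0 ?size_XaddC.
have [d hd] : exists d, (G t2)`_d != 0.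
  by exists (size (G t2)).-1; rewrite -/(lead_coef _) lead_coef_eq0.
set b := normc (G t2)`_d.
have b0 : 0 < b by rewrite lt_neqAle normc_ge0 andbT eq_sym normc_eq0.
pose K := (1 + e'^-1) ^+ m; have K0 : 0 < K by rewrite exprn_gt0 // addr_gt0 // invr_gt0.
have b4 : 0 < b / 4 by rewrite divr_gt0.
have bK : 0 < b / 4 / K by rewrite divr_gt0.
have [d3 d30 hd3] := poly_continuous (g d) t2 b4.
have [d4 d40 hd4] := poly_continuous (g 0%N) t2 bK.
(* [d2] keeps [P(t1, w)] nonzero, [1 / 2] keeps [w] in the disk, [d3] makes the [d]-th coefficient
   at least [3 b / 4], and [d4] makes the constant term at most [b / (4 K)]. *)
pose D := Num.min (Num.min d2 (2^-1)) (Num.min d3 d4).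
have D0 : 0 < D by rewrite !lt_min d20 d30 d40 invr_gt0 ltr0n.
have [D2 Dh D3 D4] : [/\ D <= d2, D <= 2^-1, D <= d3 & D <= d4].
  by rewrite !ge_min !lexx !orbT.
pose w := Complex (1 - D) 0 * t2.
have wt : w - t2 = Complex (- D) 0 * t2.
  by rewrite /w -[X in _ - X]mul1r -mulrBl; congr (_ * _); simpc; congr Complex; ring.
have nr (r : R) : normc (Complex r 0) = `|r| by rewrite /= expr0n addr0 sqrtr_sqr.
have nwt : normc (w - t2) = D.
  by rewrite wt ComplexField.Normc.normcM n2 mulr1 nr normrN gtr0_norm.
have nw : normc w < 1.
  by rewrite ComplexField.Normc.normcM n2 mulr1 nr ger0_norm; lra.
have t20 : t2 != 0 by rewrite -normc_eq0 n2 oner_eq0.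
have wne : w != t2 by rewrite -subr_eq0 -normc_eq0 nwt gt_eqF.
have g0w : (G w).[0] != 0.
  rewrite Gev add0r peval_ev1; apply: contra wne => h; apply/eqP/hd2; first exact: h.
  by rewrite nwt.
have Gt0 : (g 0%N).[t2] = 0 by rewrite -gE -horner_coef0 Gev add0r.
have [z rz hz] : exists2 z, root (G w) z & normc z < e'.
  apply: (small_root (m := m) (d := d)) => //.
    rewrite size_comp_poly2 ?size_XaddC //.
    rewrite horner_coef; apply/leq_sizeP => j hj; rewrite coef_sum big1 // => k _.
    by rewrite -rmorphXn coefMC nth_default ?mul0r // (leq_trans (proj2 bP k)).
  have s0 : normc (G w).[0] <= b / 4 / K.
    rewrite horner_coef0 gE -[X in normc X](subr0 _) -Gt0; apply: hd4.
    by rewrite nwt.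
  have s1 : b - b / 4 <= normc (G w)`_d.
    have := hd3 w; rewrite nwt -!gE => /(_ D3) h.
    have : b <= normc (G w)`_d + normc ((G w)`_d - (G t2)`_d).
      rewrite /b -{1}(subKr (G w)`_d (G t2)`_d).
      by apply: le_trans (le_normcD _ _) _; rewrite normcN.
    by lra.
  have : normc (G w).[0] * K <= b / 4 by rewrite -ler_pdivlMr.
  by rewrite -/K; lra.
exists (z + t1), w; split=> //.
- by apply/eqP; rewrite -Gev.
- apply/negP => /eqP h; have := congr1 (fun T => peval T (z + t1) w) cUV.
  have -> : peval (U * P + V * prefl m n P) (z + t1) w = 0.
    have Pz : peval P (z + t1) w = 0 by apply/eqP; rewrite -Gev.
    rewrite /peval in h Pz *; by rewrite !hornerE h Pz !mulr0 addr0.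
  rewrite /peval hornerC => rc; move: rz; rewrite rootE.
  have -> : z = 0; last by rewrite (negbTE g0w).
  have := hd1 (z + t1); rewrite rootE rc eqxx addrK => /(_ isT).
  move=> hh; have : z + t1 = t1.
    by apply: hh; apply: ltW; apply: lt_le_trans hz _; rewrite ge_min lexx orbT.
  by move/eqP; rewrite -subr_eq0 addrK => /eqP.
- by rewrite addrK; apply: lt_le_trans hz _; rewrite ge_min lexx.
Qed.

(** * A zero on the torus forces numerical radius one *)

(** The coefficients of [q(z1) / (1 - conj w z2)]. *)
Definition geo q w : arr := fun j k => q`_j * conjc w ^+ k.

Lemma H2_geo q w : normc w < 1 -> H2 (geo q w).
Proof.
move=> hw; have w1 : normsq w < 1 by rewrite -normc_sq expr_lt1 ?normc_ge0.
have w0 := normsq_ge0 w; have p0 : 0 < 1 - normsq w by rewrite subr_gt0.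
pose A := \sum_(j < size q) normsq q`_j.
apply: (H2_bound (M := A * (1 - normsq w)^-1)) => N.
have -> : squaresum (fun j k => normsq (geo q w j k)) N
    = (\sum_(j < N) normsq q`_j) * \sum_(k < N) normsq w ^+ k.
  rewrite mulr_suml; apply: eq_bigr => j _; rewrite mulr_sumr; apply: eq_bigr => k _.
  by rewrite normsqM normsqX normsqJ.
apply: ler_pM.
- by apply: sumr_ge0 => j _; apply: normsq_ge0.
- by apply: sumr_ge0 => j _; apply: exprn_ge0.
- have q0 j : (size q <= j)%N -> normsq q`_j = 0.
    by move=> hj; rewrite nth_default // normsq0.
  rewrite /A -(sum_ord_trunc q0 (leq_maxl _ N)).
  rewrite -!(big_mkord xpredT (fun j => normsq q`_j)).
  rewrite [leRHS](big_cat_nat (leq0n N) (leq_maxr _ N)) /= lerDl sumr_ge0 // => j _.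
  exact: normsq_ge0.
- rewrite -[leRHS]mul1r ler_pdivlMr // mulrC.
  have -> : (1 - normsq w) * (\sum_(k < N) normsq w ^+ k) = 1 - normsq w ^+ N.
    by rewrite -opprB mulNr -subrX1 opprB.
  by rewrite lerBlDr lerDl exprn_ge0.
Qed.

(** This is [conj w^n P(z1, 1 / conj w)], in a form that makes sense at [w = 0] too. For [p~] in
    place of [P] it is [z1^m conj p(1 / conj z1, w)]. *)
Definition flat (m n : nat) P w : {poly C} :=
  \poly_(j < m.+1) \sum_(l < n.+1) pcoef P j l * conjc w ^+ (n - l).

(** From degree [n] in [z2] on, all coefficients of [P] meet the geometric series, which then
    continues with ratio [conj w]. *)
Lemma conv_geo m n P q w j k : bideg_le m n P ->
  conv (pcoef P) (geo q w) j (n + k)%N = conjc w ^+ k * (flat m n P w * q)`_j.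
Proof.
move=> bP; rewrite coefM mulr_sumr; apply: eq_bigr => -[i hi] _ /=.
rewrite /flat coef_poly; case: ltnP => him; last first.
  by rewrite mul0r mulr0 big1 // => l _; rewrite (pcoef_bideg1 _ bP) ?mul0r.
pose F l := pcoef P i l * geo q w (j - i)%N (n + k - l)%N.
rewrite [LHS](@sum_ord_trunc _ F n.+1) ?ltnS ?leq_addr //.
  rewrite mulr_suml mulr_sumr; apply: eq_bigr => -[l hl] _; rewrite /F /geo /=.
  rewrite (_ : (n + k - l)%N = (k + (n - l))%N); last by lia.
  by rewrite exprD; ring.
by move=> l hl; rewrite /F (pcoef_bideg2 _ bP) ?mul0r.
Qed.

Lemma prefl_invol m n P : bideg_le m n P -> prefl m n (prefl m n P) = P.
Proof.
move=> bP; apply/polyP => k; apply/polyP => j.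
rewrite -[LHS]/(pcoef _ j k) -[RHS]/(pcoef P j k) !pcoef_prefl !leq_subr /=.
case: leqP => hj /=; last by rewrite (pcoef_bideg1 _ bP).
by case: leqP => hk; rewrite ?conjcK ?subKn // (pcoef_bideg2 _ bP).
Qed.

Lemma flat_eval m n P z w : z != 0 ->
  peval (prefl m n P) z w = conjc (flat m n P w).[(conjc z)^-1] * z ^+ m.
Proof.
move=> z0; rewrite (peval_bideg _ _ (bideg_prefl m n P)) horner_poly rmorph_sum.
rewrite mulr_suml (reindex_inj rev_ord_inj); apply: eq_bigr => -[i hi] _ /=.
rewrite (reindex_inj rev_ord_inj) /= rmorphM mulrAC rmorph_sum !mulr_suml.
apply: eq_bigr => -[l hl] _ /=; rewrite !subSS pcoef_prefl !leq_subr /= !subKn //.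
rewrite rmorphM !rmorphXn /= conjcK rmorphV ?unitfE ?conjc_eq0 //= conjcK.
have zi : z ^+ i != 0 by rewrite expf_neq0.
have -> : z ^+ m = z ^+ (m - i) * z ^+ i by rewrite -exprD subnK.
by rewrite exprVn; field.
Qed.

(** Backward shifts in [z2] multiply [1 / (1 - conj w z2)] by [conj w], while those in [z1] lower
    the exponent of [z1^m]. *)
Lemma adj_geo m n P w : adj m n P (geo 'X^m w) = geo (flat m n (prefl m n P) w) w.
Proof.
apply: arrP => j k; rewrite /adj /geo /flat coef_poly.
have X0 i l : (j + i)%N != m ->
    conjc (pcoef P i l) * (('X^m : {poly C})`_(j + i) * conjc w ^+ (k + l)) = 0.
  by move=> ne; rewrite coefXn (negbTE ne) mul0r mulr0.
case: ltnP => hj; last first.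
  by rewrite mul0r big1 // => i _; rewrite big1 // => l _; apply: X0; lia.
have hi : (m - j < m.+1)%N by rewrite ltnS leq_subr.
rewrite (bigD1 (Ordinal hi)) //= [X in _ + X]big1 ?addr0; last first.
  move=> -[i hi'] ne; apply: big1 => l _; apply: X0.
  by apply: contra ne => /eqP /= e; apply/eqP/val_inj => /=; rewrite -e addKn.
rewrite mulr_suml (reindex_inj rev_ord_inj); apply: eq_bigr => -[l hl] _ /=.
rewrite subSS subnKC // coefXn eqxx pcoef_prefl -ltnS hj -ltnS hl /=.
by rewrite mul1r exprD mulrCA mulrC.
Qed.

Section ZeroOnTorus.
Variables (m n : nat) (p : {poly {poly C}}) (S1 S2 : set arr).
Hypothesis bp : bideg_le m n p.
Hypothesis nzp : forall z1 z2, normc z1 < 1 -> normc z2 < 1 -> peval p z1 z2 != 0.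
Local Notation pt := (prefl m n p).
Hypothesis S2scale : forall z s, S2 s -> S2 (arr_scale z s).
Hypothesis ort : forall s1 s2, S1 s1 -> S2 s2 -> ip s1 s2 = 0.
Hypothesis S1K : S1 `<=` KTheta p pt.
Hypothesis S2K : S2 `<=` KTheta p pt.
Hypothesis dec : forall h, KTheta p pt h ->
  exists s1 s2, [/\ S1 s1, S2 s2 & h = arr_add s1 s2].
Hypothesis S1z : forall s, S1 s -> S1 (Mz1 s).
Hypothesis S2z : forall s, S2 s -> S2 (Mz2 s).

Let S1H s : S1 s -> H2 s. Proof. by move=> /S1K[]. Qed.
Let S2H s : S2 s -> H2 s. Proof. by move=> /S2K[]. Qed.

(** By [adj_geo] this is the pairing of [p f] with [z1^m / (1 - conj w z2)], and [p f] has no term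
    of degree [m] in [z1]. *)
Lemma ip_geo_flat f w : normc w < 1 -> S2 f -> ip f (geo (flat m n pt w) w) = 0.
Proof.
move=> hw Sf; rewrite -adj_geo -(ip_conv_adj bp (S2H Sf) (H2_geo _ hw)) ipE.
have e j k : conv (pcoef p) f j k * conjc (geo 'X^m w j k) = 0.
  rewrite /geo coefXn; case: eqVneq => [->|_]; last by rewrite mul0r conjc0 mulr0.
  by have := S2_conv bp S2K S2z 0 k Sf; rewrite addn0 => ->; rewrite mul0r.
rewrite -[RHS]/(Complex 0 0) -dsum0; congr Complex; congr dsum; apply/funext => j;
  by apply/funext => k; rewrite e.
Qed.

(* The compression of [z1] to [S2] has the eigenvector [P_{S2} u] for
   [u = d(z1) / (1 - conj w z2)], where [d(z1) = z1^m conj p(1 / conj z1, w) / (z1 - kappa)]. *)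
Lemma eigenvector_of_zero z w : normc w < 1 -> peval p z w = 0 -> peval pt z w != 0 ->
  exists2 h, S2 h & h <> arr0 R /\
    forall f, S2 f -> ip f (Mz1 h) = ip f (arr_scale (conjc z)^-1 h).
Proof.
move=> hw pz ptz; have n0 : normc 0 < 1 by rewrite ComplexField.Normc.normc0.
have z0 : z != 0 by apply/eqP => e; move: pz (nzp n0 hw); rewrite e => ->; rewrite eqxx.
pose kap := (conjc z)^-1; pose ps := flat m n pt w; pose pf := flat m n p w.
have bpt : bideg_le m n pt := bideg_prefl m n p.
have pE z' : z' != 0 -> peval p z' w = conjc ps.[(conjc z')^-1] * z' ^+ m.
  by move=> z'0; rewrite -{1}(prefl_invol bp) flat_eval.
have ps0 : ps != 0.
  (* At the nonzero point [1 / 2] of the disk [pE] would produce a zero of [p] in the bidisk. *)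
  apply/eqP => e; have h0 : (2^-1 : C) != 0 by rewrite invr_eq0 pnatr_eq0.
  have h1 : normc 2^-1 < 1.
    rewrite ComplexField.Normc.normcV (_ : normc 2 = 2) ?invf_lt1 ?ltr1n ?ltr0n //.
    by rewrite normcMn ComplexField.Normc.normc1.
  by have := nzp h1 hw; rewrite pE // e horner0 conjc0 mul0r eqxx.
have rps : root ps kap.
  move: pz; rewrite pE // => /eqP; rewrite mulf_eq0 expf_eq0 (negbTE z0) andbF orbF.
  by rewrite conjc_eq0.
(* By [flat_eval], [c] is nonzero because [p~(z, w)] is. *)
set c := pf.[kap]; have c0 : c != 0.
  apply: contra ptz => /eqP e; rewrite flat_eval // -/pf -/kap -/c e conjc0 mul0r //.
have /factor_theorem [d hd] := rps.
have /factor_theorem [aq ha] : root (pf - c%:P) kap by rewrite rootE !hornerE subrr.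
have X0 : 'X - kap%:P != 0 by rewrite polyXsubC_eq0.
have d0 : d != 0 by apply: contraNneq ps0 => d0; rewrite hd d0 mul0r.
have szd : (size d <= m)%N.
  have : (size ps <= m.+1)%N by apply: size_poly.
  by rewrite hd size_Mmonic ?monicXsubC // size_XsubC addn2.
(* Multiplied by [z1 - kap], the left side is [pf ps - ps (pf - c) = c ps]. *)
have key : pf * d - ps * aq = c *: d.
  apply: (mulIf X0); rewrite mulrBl -[pf * d * _]mulrA -hd -[ps * aq * _]mulrA -ha.
  by rewrite -scalerAl -hd -mul_polyC; ring.
pose u := geo d w; pose b := geo aq w.
have hu : H2 u := H2_geo _ hw; have hb : H2 b := H2_geo _ hw.
(* The projection of [u] to [KTheta] is [k = u - p~ b / p]: by [key], the terms of [p k] of degree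
   at least [n] in [z2] have degree less than [m] in [z1]. *)
have [ci hci] := conv_inv (pcoef00_neq0 nzp).
pose x := conv ci b; have px : conv (pcoef p) x = b by rewrite /x convA hci conv1l.
pose t := conv (pcoef pt) x.
have ht : H2 t by apply: (theta_H2 bp nzp); rewrite px.
have pt' : conv (pcoef p) t = conv (pcoef pt) b by rewrite /t convCA px.
have Tt : ThetaH2 p pt t by split=> //; exists b.
pose k := arr_sub u t; have hk : H2 k := H2_sub hu ht.
have pk j l : conv (pcoef p) k j (n + l)%N = conjc w ^+ l * (c * d`_j).
  rewrite /k conv_sub pt' /arr_sub (conv_geo _ _ _ _ bp) (conv_geo _ _ _ _ bpt).
  by rewrite -mulrBr -coefB key coefZ.
have Kk : KTheta p pt k.
  apply: (KTheta_of_conv bp nzp) => // i l; rewrite pk [d`__]nth_default ?mulr0 //.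
  by apply: leq_trans szd (leq_addr _ _).
have [s1 [h [Ss1 Sh ek]]] := dec Kk; have hh := S2H Sh; have hs1 := S1H Ss1.
exists h => //; split.
  (* If [h = 0] then [k] lies in [S1], so [S1_conv] annihilates the coefficients [c d_j] of [z2^n]
     in [p k], and [d] would vanish. *)
  move=> h0; have ks : k = s1.
    by rewrite ek h0; apply: arrP => i l; rewrite /arr_add addr0.
  case/eqP: d0; apply/polyP => j; rewrite coef0.
  have := pk j 0%N; rewrite ks (S1_conv bp S1K S1z _ _ Ss1) expr0 mul1r.
  by move=> /esym/eqP; rewrite mulf_eq0 (negbTE c0) => /eqP.
have ipfu f : S2 f -> ip f h = ip f u.
  move=> Sf; have hf := S2H Sf.
  have e1 : ip f k = ip f h.
    rewrite ek ipDr // (ipC hs1 hf) (ort Ss1 Sf) conjc0 add0r //.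
  have [_ Kf] := S2K Sf.
  by rewrite -e1 /k ipBr // (Kf _ Tt) subr0.
(* [(z1 - kap) u] equals [ps(z1) / (1 - conj w z2)], which is orthogonal to [S2] by
   [ip_geo_flat]. *)
have ipMu f : S2 f -> ip f (Mz1 u) = conjc kap * ip f u.
  move=> Sf; have hf := S2H Sf; have hMu := H2_Mz1 hu.
  apply/eqP; rewrite -subr_eq0 -ipZr // -ipBr //; last exact: H2_scale.
  rewrite (_ : arr_sub _ _ = geo ps w) ?ip_geo_flat //.
  apply: arrP => -[|j] l; rewrite /arr_sub /arr_scale /u /geo /= hd mulrBr coefB coefMX
    coefMC /=; by ring.
(* To pass from [u] to [h], move [z1] onto [f] as [B1 f]: this stays in [S2], whose elements pair
   equally with [h] and [u]. *)
move=> f Sf; have hf := S2H Sf; have hMh := H2_Mz1 hh; have hBf := H2_B1 hf.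
have SBf := S2_B1 ort S1K S2K dec S1z Sf.
rewrite (ipC hMh hf) (ip_Mz1 hh hf) -(ipC hh hBf) (ipfu _ SBf) (ipC hu hBf).
rewrite -(ip_Mz1 hu hf) -(ipC (H2_Mz1 hu) hf) (ipMu _ Sf) -(ipfu _ Sf) ipZr //.
Qed.

Lemma numrange_of_zero z w : normc w < 1 -> peval p z w = 0 -> peval pt z w != 0 ->
  numrange_compr_z1 S2 (conjc z)^-1.
Proof.
move=> hw pz ptz; have [h Sh [h0 hf]] := eigenvector_of_zero hw pz ptz.
set kap := (conjc z)^-1 in hf *; have hh := S2H Sh; have hM := H2_Mz1 hh.
have np : 0 < nsq h.
  rewrite lt_neqAle nsq_ge0 // andbT eq_sym; apply/eqP => e; apply: h0.
  exact: nsq_eq0.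
pose al : C := Complex (Num.sqrt (nsq h))^-1 0; pose h' := arr_scale al h.
have hh' : H2 h' by apply: H2_scale.
have h'1 : nsq h' = 1.
  rewrite nsq_scale // /normsq /= expr0n addr0 exprVn sqr_sqrtr ?ltW //.
  by rewrite mulVf // gt_eqF.
exists h', (arr_scale kap h'); split=> //; first exact: S2scale.
- split; first by do 2!apply: S2scale.
  move=> s Ss; have hs := S2H Ss.
  have -> : arr_sub (Mz1 h') (arr_scale kap h')
      = arr_scale al (arr_sub (Mz1 h) (arr_scale kap h)).
    by apply: arrP => -[|j] k; rewrite /h' /arr_sub /arr_scale /=; ring.
  have hd : H2 (arr_sub (Mz1 h) (arr_scale kap h)) by apply: H2_sub => //; apply: H2_scale.
  rewrite ipZl // (ipC hs hd) ipBr //; last exact: H2_scale.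
  by rewrite (hf _ Ss) subrr conjc0 mulr0.
- by rewrite ipZl // ip_self h'1 mulr1.
Qed.

Lemma zero_numradius1 (t1 t2 : C) : pcoprime p pt -> normc t1 = 1 -> normc t2 = 1 ->
  peval p t1 t2 = 0 -> numradius_compr_z1 S2 = 1.
Proof.
move=> cop n1 n2 pt0; rewrite /numradius_compr_z1; set E := (X in sup X).
have ubE : ubound E 1.
  move=> _ [_ [h [y [Sh h1 [Sy py] ->]]] <-].
  have [hh hy] := (S2H Sh, S2H Sy).
  have -> : ip y h = ip (Mz1 h) h.
    apply/esym/eqP; rewrite -subr_eq0; apply/eqP; rewrite -ipBl //; last exact: H2_Mz1.
    exact: py.
  have : normsq (ip (Mz1 h) h) <= 1.
    by apply: le_trans (ip_CS (H2_Mz1 hh) hh) _; rewrite nsq_Mz1 // h1 mulr1.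
  by rewrite -normc_sq expr_le1 ?normc_ge0.
(* A zero with [z] within [e] of [t1] gives the eigenvalue [1 / conj z], of modulus at least
   [1 / (1 + e)]. *)
have big (e : R) : 0 < e -> exists2 y, E y & (1 + e)^-1 <= y.
  move=> e0; have [z [w [hw pz ptz hz]]] := zero_near_torus bp cop n1 n2 pt0 e0.
  exists (normc (conjc z)^-1).
    by exists (conjc z)^-1 => //; apply: numrange_of_zero hw pz ptz.
  have hn : normc z <= 1 + e.
    rewrite -(subrK t1 z) addrC -n1; apply: le_trans (le_normcD _ _) _.
    by rewrite lerD2l ltW.
  have z0 : 0 < normc z.
    rewrite lt_neqAle normc_ge0 andbT eq_sym normc_eq0; apply/eqP => e'.
    have n0 : normc 0 < 1 by rewrite ComplexField.Normc.normc0.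
    by move: pz (nzp n0 hw); rewrite e' => ->; rewrite eqxx.
  by rewrite ComplexField.Normc.normcV normcJ lef_pV2 ?posrE ?addr_gt0.
have [y0 Ey0 _] := big 1 ltr01.
apply/le_anti/andP; split; first by apply: ge_sup => //; exists y0.
rewrite leNgt; apply/negP => lt; have [e eE] : exists e, e = 1 - sup E by eexists.
have e0 : 0 < e by rewrite eE subr_gt0.
have [y Ey hy] := big e e0; have hE : has_ubound E by exists 1.
have le := le_trans hy (ub_le_sup hE Ey).
have : 1 - e < (1 + e)^-1.
  by rewrite -[ltRHS]mul1r ltr_pdivlMr ?addr_gt0 //; have := mulr_gt0 e0 e0; lra.
by move=> lt'; lra.
Qed.

End ZeroOnTorus.

End HardySpace.

Theorem theorem3p7 (R : realType) (m n : nat) (p : {poly {poly R[i]}})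
  (S1 S2 : set (arr R)) :
  bideg_le m n p ->
  (forall z1 z2 : R[i], ComplexField.Normc.normc z1 < 1 -> ComplexField.Normc.normc z2 < 1 -> peval p z1 z2 != 0) ->
  pcoprime p (prefl m n p) ->
  closed_subspace S1 -> closed_subspace S2 ->
  (forall s1 s2, S1 s1 -> S2 s2 -> ip s1 s2 = 0) ->
  S1 `<=` KTheta p (prefl m n p) -> S2 `<=` KTheta p (prefl m n p) ->
  (forall h, KTheta p (prefl m n p) h ->
     exists s1 s2, [/\ S1 s1, S2 s2 & h = arr_add s1 s2]) ->
  (forall s, S1 s -> S1 (Mz1 s)) ->
  (forall s, S2 s -> S2 (Mz2 s)) ->
  (numradius_compr_z1 S2 = 1 <->
   exists z1 z2 : R[i], [/\ ComplexField.Normc.normc z1 = 1, ComplexField.Normc.normc z2 = 1 & peval p z1 z2 = 0]).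
Proof.
move=> bp nzp cop _ [S2H _ _ S2scale _] ort S1K S2K dec S1z S2z; split.
  by apply: (numradius1_zero bp S2H) => s j k Ss; apply: (S2_conv bp S2K S2z).
move=> [z1 [z2 [n1 n2 pz]]].
exact: (zero_numradius1 bp nzp S2scale ort S1K S2K dec S1z S2z cop n1 n2 pz).
Qed.
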